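(* As an $\mathfrak{A}$-module, the coinvariant space $\overline{\mathcal{S}_2}$ is generated by the images of the inverse images of the three elements $$\zeta,\qquad z_+(z'_-)^2,\qquad z_+(\zeta'_-)^2$$ of the Fock space $\mathcal{F}$ under the isomorphism $\iota:\mathcal{S}_2\to\mathcal{F}$.
   Context: $\mathfrak{s}_2=\mathfrak{sl}_2\times\mathbb{R}^2\times\mathbb{R}_2$, with elements $(y,v,w)$ ($v$ a column, $w$ a row) and $\mathrm{GL}_2$ acting by $g\cdot(y,v,w)=(gyg^{-1},gv,wg^{-1})$. $\mathbb{C}[\mathfrak{s}_2]$ and $\mathbb{C}\{\mathfrak{s}_2\}$ are the ring of complex polynomial functions and the Weyl algebra of polynomial differential operators. Use the linear coordinates $x_1=2y_{11}$, $x_2=y_{12}+y_{21}$, $x_3=y_{12}-y_{21}$, $x'_1=v_1+w_1$, $x'_2=v_2+w_2$, $x'_3=w_1-v_1$, $x'_4=w_2-v_2$; then $Q_0:=\mathrm{tr}(y^2)=\frac12(x_1^2+x_2^2-x_3^2)$ and $Q_1:=2wv=\frac12(x_1'^2+x_2'^2-x_3'^2-x_4'^2)$. Put $\varphi=e^{-\pi(x_1^2+x_2^2+x_3^2+x_1'^2+\dots+x_4'^2)}$ and $\mathcal{S}_2=\mathbb{C}[\mathfrak{s}_2]\varphi$. Fock model: $\mathcal{F}=\mathbb{C}[z_1,z_2,\zeta,z'_1,z'_2,\zeta'_3,\zeta'_4]$ with variables corresponding in this order to $x_1,x_2,x_3,x'_1,x'_2,x'_3,x'_4$. The isomorphism $\iota:\mathcal{S}_2\to\mathcal{F}$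 is characterised by $\iota(\varphi)=1$ and by intertwining, for each corresponding pair $(x,z)$, the operator $2\pi x-\partial_x$ with multiplication by $z$ and $x+\frac1{2\pi}\partial_x$ with $2\partial_z$; i.e. $\iota^{-1}(h)$ is $h$ with every variable $z$ replaced by $2\pi x-\partial_x$, applied to $\varphi$. Set $z_\pm=z_1\pm iz_2$, $z'_\pm=z'_1\pm iz'_2$, $\zeta'_\pm=\zeta'_3\pm i\zeta'_4$. Algebra $\mathfrak{A}$: for a real quadratic space $(W,Q)$ of dimension $N$ with coordinates such that $Q=\frac12(\sum_{j\le a}x_j^2-\sum_{j>a}x_j^2)$, the infinitesimal Weil representation $\omega:\mathfrak{sl}_2(\mathbb{C})\to\mathbb{C}\{W\}$ is $\omega\begin{pmatrix}1&\\&-1\end{pmatrix}=\frac N2+\sum x_j\partial_{x_j}$, $\omega\begin{pmatrix}0&1\\0&0\end{pmatrix}=2\pi iQ$, $\omega\begin{pmatrix}0&0\\1&0\end{pmatrix}=\frac i{4\pi}(\sum_{j\le a}\partial_{x_j}^2-\sum_{j>a}\partial_{x_j}^2)$. Applied to $(\mathfrak{sl}_2,Q_0)$ and $(\mathbb{R}^2\times\mathbb{R}_2,Q_1)$ it gives $\omega:\mathfrak{sl}_2\times\mathfrak{sl}_2\to\mathbb{C}\{\mathfrak{s}_2\}^{\mathrm{GL}_2}$. $\mathfrak{A}\subset\mathbb{C}\{\mathfrak{s}_2\}^{\mathrm{GL}_2}$ is the $\mathbb{C}$-subalgebra generated by the image of $\omega$ and $\mathcal{A}=\mathbb{C}[\mathfrak{s}_2]^{\mathrm{GL}_2}=\mathbb{C}[\det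 y,wv,wyv]$. It acts on $\mathcal{S}_2$ by differentiation. Coinvariants: $\mathrm{GL}_2(\mathbb{R})$ acts on functions by $(g\cdot\Phi)(Y)=\Phi(g^{-1}Y)$; differentiating gives an action of $\mathfrak{gl}_2(\mathbb{R})$ on $\mathcal{S}_2$, and $O(2)$ acts on $\mathcal{S}_2$. With $\eta(g)=\mathrm{sgn}\det g$, $\overline{\mathcal{S}_2}$ is the quotient of $\mathcal{S}_2$ by the subspace spanned by all $L(\Phi)$ ($L\in\mathfrak{gl}_2(\mathbb{R})$, $\Phi\in\mathcal{S}_2$) and all $k\cdot\Phi-\eta(k)\Phi$ ($k\in O(2)$, $\Phi\in\mathcal{S}_2$). The $\mathfrak{A}$-action descends to $\overline{\mathcal{S}_2}$. *)

(* Defs.v *)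
From HB Require Import structures.
From mathcomp Require Import all_boot all_order all_algebra.
From mathcomp Require Import complex mpoly.
From mathcomp Require Import classical_sets functions reals.
From mathcomp Require Import topology normedtype sequences derive realfun exp trigo.
From mathcomp Require Import ring.

Set Implicit Arguments.
Unset Strict Implicit.
Unset Printing Implicit Defensive.

Import Order.TTheory GRing.Theory Num.Theory.
Import numFieldNormedType.Exports.

Local Open Scope classical_set_scope.
Local Open Scope complex_scope.
Local Open Scope ring_scope.

Section Space.
Variable R : realType.

(* A point (y, v, w) of sl_2 x R^2 x R_2 is represented by the row vector of
   its coordinates (x_1, x_2, x_3, x'_1, x'_2, x'_3, x'_4). *)
Definition s2 := 'rV[R]_7.

Definition coords (Y : 'M[R]_2 * 'cV[R]_2 * 'rV[R]_2) : s2 :=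
  let: (y, v, w) := Y in
  \row_j [:: 2 * y 0 0; y 0 1 + y 1 0; y 0 1 - y 1 0;
             v 0 0 + w 0 0; v 1 0 + w 0 1;
             w 0 0 - v 0 0; w 0 1 - v 1 0]`_j.

Definition mx2 (a b c d : R) : 'M[R]_2 :=
  \matrix_(i, j) if i == 0 then (if j == 0 then a else b)
                 else (if j == 0 then c else d).

Definition point (X : s2) : 'M[R]_2 * 'cV[R]_2 * 'rV[R]_2 :=
  let x (k : nat) := X 0 (inord k) in
  (mx2 (x 0%N / 2) ((x 1%N + x 2%N) / 2) ((x 1%N - x 2%N) / 2) (- (x 0%N / 2)),
   \col_i (if i == 0 then (x 3%N - x 5%N) / 2 else (x 4%N - x 6%N) / 2),
   \row_j (if j == 0 then (x 3%N + x 5%N) / 2 else (x 4%N + x 6%N) / 2)).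

Lemma coordsK (Y : 'M[R]_2 * 'cV[R]_2 * 'rV[R]_2) :
  \tr Y.1.1 = 0 -> point (coords Y) = Y.
Proof.
case: Y => [[y v] w] /=; rewrite /mxtrace 2!big_ord_recl big_ord0 addr0.
have -> : lift ord0 ord0 = 1 :> 'I_2 by apply/val_inj.
move=> /eqP; rewrite addrC addr_eq0 => /eqP y11.
rewrite /point /coords !mxE !inordK //=.
have E2 (i : 'I_2) : (i == 0) || (i == 1) by case: i => [[|[|]]].
congr (_, _, _).
- apply/matrixP => i j; rewrite mxE.
  by case/orP: (E2 i) => /eqP->; case/orP: (E2 j) => /eqP-> /=;
    rewrite ?y11; field.
- apply/colP => i; rewrite mxE.
  by case/orP: (E2 i) => /eqP-> /=; field.
- apply/rowP => i; rewrite mxE.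
  by case/orP: (E2 i) => /eqP-> /=; field.
Qed.

Lemma pointK (X : s2) : coords (point X) = X.
Proof.
apply/rowP => j; rewrite /coords /point !mxE /=.
case: j => [[|[|[|[|[|[|[|//]]]]]]] lj] /=;
  rewrite -[X in _ = X]/(X 0 _);
  set x := (X 0 (Ordinal lj));
  have -> : x = X 0 (inord (Ordinal lj)) by rewrite /x inord_val.
all: by rewrite /=; field.
Qed.

Lemma tr_point (X : s2) : \tr (point X).1.1 = 0.
Proof.
by rewrite /mxtrace 2!big_ord_recl big_ord0 addr0 !mxE /= addrN.
Qed.

Definition act (g : 'M[R]_2) (X : s2) : s2 :=
  let: (y, v, w) := point X in
  coords (g *m y *m invmx g, g *m v, w *m invmx g).

End Space.

Section Operators.
Variable R : realType.
Local Notation C := R[i].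

Definition cfun := s2 R -> C.

Definition gl_translate (g : 'M[R]_2) (Phi : cfun) : cfun :=
  fun X => Phi (act (invmx g) X).

Definition cderiv0 (f : R -> C) : C :=
  (fun t => complex.Re (f t))^`()%classic 0
    +i* (fun t => complex.Im (f t))^`()%classic 0.

Definition partial (j : 'I_7) (Phi : cfun) : cfun :=
  fun X => cderiv0 (fun t => Phi (X + t *: delta_mx 0 j)).

(* The differential of the GL_2(R)-action at L, computed along the curve
   1 + tL, which lies in GL_2(R) for small t and has velocity L at t = 0. *)
Definition gl_deriv (L : 'M[R]_2) (Phi : cfun) : cfun :=
  fun X => cderiv0 (fun t => gl_translate (1%:M + t *: L) Phi X).

Definition coordf (j : 'I_7) : cfun := fun X => (X 0 j)%:C.

Definition pfun (p : {mpoly C[7]}) : cfun := fun X => p.@[fun j => coordf j X].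

Definition gauss : cfun :=
  fun X => (expR (- (pi * \sum_j X 0 j ^+ 2)))%:C.

Definition S2 : set cfun :=
  [set Phi | exists p : {mpoly C[7]}, Phi = pfun p * gauss].

Definition creation (j : 'I_7) (Phi : cfun) : cfun :=
  (2 * pi)%:C *: (coordf j * Phi) - partial j Phi.

(* The creation operators commute on S2, so their order is immaterial. *)
Definition creation_monomial (m : 'X_{1..7}) : cfun :=
  foldr (fun j Phi => iter (m j) (creation j) Phi) gauss (enum 'I_7).

(* {mpoly C[7]} plays the role of the Fock space; its variables 0..6 are
   z_1, z_2, zeta, z'_1, z'_2, zeta'_3, zeta'_4. *)
Definition iota_inv (h : {mpoly C[7]}) : cfun :=
  \sum_(m <- msupp h) h@_m *: creation_monomial m.

Definition fock_var (k : nat) : {mpoly C[7]} := 'X_(inord k).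
Definition fock_zeta : {mpoly C[7]} := fock_var 2.
Definition fock_zp : {mpoly C[7]} := fock_var 0 + 'i%C *: fock_var 1.
Definition fock_zm' : {mpoly C[7]} := fock_var 3 - 'i%C *: fock_var 4.
Definition fock_zetam' : {mpoly C[7]} := fock_var 5 - 'i%C *: fock_var 6.

(* The two quadratic spaces are spanned by complementary blocks of coordinates;
   qsgn j is the sign of x_j ^+ 2 in the quadratic form of its block. *)
Definition W0 : {set 'I_7} := [set j : 'I_7 | (j < 3)%N].
Definition W1 : {set 'I_7} := ~: W0.
Definition qsgn (j : 'I_7) : R :=
  if (j : nat) \in [:: 2; 5; 6]%N then -1 else 1.
Definition qform (W : {set 'I_7}) (X : s2 R) : R :=
  2^-1 * \sum_(j in W) qsgn j * X 0 j ^+ 2.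

Lemma qform_W0 (X : s2 R) :
  let y := (point X).1.1 in qform W0 X = \tr (y *m y).
Proof.
rewrite /= /qform (eq_bigr (fun j => qsgn j * X 0 (inord j) ^+ 2)); last first.
  by move=> j _; rewrite inord_val.
rewrite big_mkcond /mxtrace /= !big_ord_recl !big_ord0 !inE /=.
rewrite !mxE !big_ord_recl !big_ord0 !mxE /= /qsgn /= /bump /=.
by field.
Qed.

Lemma qform_W1 (X : s2 R) :
  let: (_, v, w) := point X in qform W1 X = 2 * (w *m v) 0 0.
Proof.
rewrite /= /qform (eq_bigr (fun j => qsgn j * X 0 (inord j) ^+ 2)); last first.
  by move=> j _; rewrite inord_val.
rewrite big_mkcond /= !big_ord_recl !big_ord0 !inE /=.
rewrite !mxE !big_ord_recl !big_ord0 !mxE /= /qsgn /= /bump /=.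
by field.
Qed.

Definition weil_h (W : {set 'I_7}) (Phi : cfun) : cfun :=
  (#|W|%:R / 2) *: Phi + \sum_(j in W) coordf j * partial j Phi.
Definition weil_e (W : {set 'I_7}) (Phi : cfun) : cfun :=
  fun X => (2 * pi)%:C * 'i%C * (qform W X)%:C * Phi X.
Definition weil_f (W : {set 'I_7}) (Phi : cfun) : cfun :=
  ('i%C / (4 * pi)%:C) *:
    \sum_(j in W) (qsgn j)%:C *: partial j (partial j Phi).

Definition weil (W : {set 'I_7}) (A : 'M[C]_2) (Phi : cfun) : cfun :=
  A 0 0 *: weil_h W Phi + A 0 1 *: weil_e W Phi + A 1 0 *: weil_f W Phi.

Definition omega (A B : 'M[C]_2) : cfun -> cfun :=
  fun Phi => weil W0 A Phi + weil W1 B Phi.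

Definition GL2_invariant (p : {mpoly C[7]}) : Prop :=
  forall g : 'M[R]_2, g \in unitmx ->
    forall X : s2 R, pfun p (act g X) = pfun p X.

(* An element of the Weyl algebra is represented by an operator that extends its
   action on S2 by differentiation; only the restriction to S2 is used.  The
   product of the Weyl algebra is composition of operators. *)
Definition is_subalgebra (M : set (cfun -> cfun)) : Prop :=
  [/\ M id,
      forall D E, M D -> M E -> M (fun Phi => D Phi + E Phi),
      forall (c : C) D, M D -> M (fun Phi => c *: D Phi) &
      forall D E, M D -> M E -> M (D \o E)].

Definition frakA_gens : set (cfun -> cfun) :=
  [set D | (exists A B : 'M[C]_2, [/\ \tr A = 0, \tr B = 0 & D = omega A B])
        \/ (exists2 p, GL2_invariant p & D = (fun Phi => pfun p * Phi))].

Definition frakA : set (cfun -> cfun) := smallest is_subalgebra frakA_gens.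

Definition is_subspace (M : set cfun) : Prop :=
  [/\ M 0, forall Phi Psi, M Phi -> M Psi -> M (Phi + Psi) &
      forall (c : C) Phi, M Phi -> M (c *: Phi)].

Definition eta (g : 'M[R]_2) : C := (Num.sg (\det g))%:C.

Definition coinv_gens : set cfun :=
  [set Psi | (exists L Phi, S2 Phi /\ Psi = gl_deriv L Phi)
          \/ (exists k Phi, [/\ k *m k^T = 1%:M, S2 Phi &
                 Psi = gl_translate k Phi - eta k *: Phi])].

(* The subspace by which S2 is divided to form the coinvariants. *)
Definition coinv_sub : set cfun := smallest is_subspace coinv_gens.

(* Equality of the images of Phi and Psi in the coinvariant space. *)
Definition coinv_eq (Phi Psi : cfun) : Prop := coinv_sub (Phi - Psi).

(* frakA acts on the quotient of S2 by coinv_sub, so the frakA-submodule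
   generated by the images of the members of fs consists of the images of the
   sums of the D i fs`_i with D i in frakA. *)
Definition coinv_generated_by (fs : seq cfun) : Prop :=
  forall Phi, S2 Phi ->
    exists2 D : nat -> cfun -> cfun, forall i, frakA (D i) &
      coinv_eq Phi (\sum_(i < size fs) D i fs`_i).

End Operators.

(* Main.v *)
From HB Require Import structures.
Require Import Defs.
From mathcomp Require Import all_boot all_order all_algebra complex mpoly.
From mathcomp Require Import boolp classical_sets functions reals.
From mathcomp Require Import topology normedtype sequences derive realfun exp trigo.
From mathcomp Require Import ring zify.

(* Write the elements of S_2 as [p * gauss] with [p] a polynomial. In top
   degree every operator involved multiplies [p] by a polynomial. With
   z_+ = x_1 + i x_2, zeta = x_3, z'_+ = x'_1 + i x'_2, zeta'_+ = x'_3 + i x'_4,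
   etc., the algebra A provides multiplication by z_+ z_-, zeta^2, z'_+ z'_-,
   zeta'_+ zeta'_- and wyv; the gl_2-relations annihilate the multiples of
   z'_+ zeta'_- + z'_- zeta'_+, of z'_+ zeta'_+ + 2i z_+ zeta and of
   z'_- zeta'_- - 2i z_- zeta, and the monomials of nonzero weight under
   rotations; the reflection relation identifies a monomial with minus its
   mirror image. By induction on the degree, all monomials reduce to zeta,
   z_+^a z'_-^(2a), z_+^a zeta'_-^(2a) and z'_+ zeta'_- - z'_- zeta'_+.
   Multiplication by wyv raises the exponent a, and the last element comes
   from zeta by applying wyv and then, to isolate one component of the result,
   the number operators, which are the images of e - f for the two copies of
   sl_2. *)

Set Implicit Arguments.
Unset Strict Implicit.
Unset Printing Implicit Defensive.

Import Order.TTheory GRing.Theory Num.Theory.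
Local Open Scope ring_scope.

(** The products supplied by the algebra arise as follows. On [p * gauss] a partial derivative acts
    on [p] as d_j - 2 pi x_j, whose leading part is multiplication by -2 pi x_j. The Euler operator
    of each block, obtained from the commutator of its Laplacian with its quadratic form, therefore
    multiplies in top degree by a multiple of the definite sum of squares. Adding and subtracting
    the indefinite form splits z_+ z_- from zeta^2, and z'_+ z'_- from zeta'_+ zeta'_-. Hence only
    Laplacians and multiplications by invariants have to be shown to descend to the coinvariants.
    The obstacle is z'_+ zeta'_- - z'_- zeta'_+: it has degree 2, the reflection relation is trivial
    on it, and wyv carries zeta from degree 1 straight to degree 4. It appears only as a lower term
    of an element of higher degree, so leading terms do not suffice there and exact identities are
    required. *)

Lemma big7 (V : zmodType) (F : 'I_7 -> V) :
  \sum_i F i = F (inord 0) + (F (inord 1) + (F (inord 2) + (F (inord 3) +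
    (F (inord 4) + (F (inord 5) + F (inord 6)))))).
Proof.
rewrite !big_ord_recl big_ord0 addr0.
by do 6?[congr (_ + _)]; congr F; apply/val_inj; rewrite /= inordK.
Qed.

(** * Polynomial differential operators *)

Section Weyl.
Variables (K : numFieldType) (n : nat) (c : K).
Local Notation P := {mpoly K[n]}.
Implicit Types (p q u : P) (i j k : 'I_n) (S : {set 'I_n}) (s : 'I_n -> K).

(* The partial derivative conjugated by a Gaussian whose logarithmic derivative
   in the j-th direction is [- c * 'X_j]. *)
Definition sder j p : P := p^`M(j) - c *: ('X_j * p).

Fact sder_is_linear j : linear (sder j).
Proof.
move=> a p q; rewrite /sder linearP mulrDr -scalerAr !scalerBr !scalerDr !scalerA.
by rewrite opprD addrACA [a * _]mulrC.
Qed.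
HB.instance Definition _ j :=
  GRing.isLinear.Build K P P *:%R (sder j) (sder_is_linear j).

Lemma sderM j u p : sder j (u * p) = u^`M(j) * p + u * sder j p.
Proof.
rewrite /sder mderivM mulrBr -addrA; congr (_ + (_ - _)).
by rewrite -scalerAr mulrCA.
Qed.

Lemma mderivXU i j : ('X_i)^`M(j) = (i == j)%:R :> P.
Proof.
rewrite mderivX mnmE; case: eqVneq => [->|_]; rewrite ?scale0r //.
rewrite scale1r (_ : (U_(j) - U_(j) = 0)%MM) ?mpolyX0 //.
by apply/mnmP => k; rewrite !mnmE subnn.
Qed.

Lemma sderC i j p : sder i (sder j p) = sder j (sder i p).
Proof.
have E a b : sder a (sder b p) = p^`M(b)^`M(a) -
    c *: ('X_a * p^`M(b) + 'X_b * p^`M(a)) - (c * (b == a)%:R) *: p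
    + (c ^+ 2) *: ('X_a * 'X_b * p).
  rewrite {2}/sder linearB linearZ /= sderM mderivXU /sder -mulr_natl.
  rewrite -!mul_mpolyC !rmorphM /= rmorph_nat; ring.
by rewrite !E mderiv_comm (eq_sym j i) (addrC ('X_i * _)) (mulrC 'X_i 'X_j).
Qed.

Definition lap S s p : P := \sum_(j in S) s j *: sder j (sder j p).

Fact lap_is_linear S s : linear (lap S s).
Proof.
move=> a p q; rewrite /lap scaler_sumr -big_split; apply: eq_bigr => j _ /=.
rewrite linearP [sder j (_ + _)]linearP /= scalerDr; congr (_ + _).
by rewrite !scalerA mulrC.
Qed.
HB.instance Definition _ S s :=
  GRing.isLinear.Build K P P *:%R (lap S s) (lap_is_linear S s).

Definition linf (M : 'I_n -> 'I_n -> K) j : P := \sum_k M j k *: 'X_k.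

Definition vfield M p : P := \sum_j linf M j * sder j p.

Fact vfield_is_linear M : linear (vfield M).
Proof.
move=> a p q; rewrite /vfield scaler_sumr -big_split; apply: eq_bigr => j _ /=.
by rewrite linearP mulrDr -scalerAr.
Qed.
HB.instance Definition _ M :=
  GRing.isLinear.Build K P P *:%R (vfield M) (vfield_is_linear M).

Lemma mderiv_linf M i j : (linf M i)^`M(j) = (M i j)%:MP.
Proof.
rewrite /linf raddf_sum (bigD1 j) //= mderivZ mderivXU eqxx big1 => [|k /negPf kj].
  by rewrite addr0 -mul_mpolyC mulr1.
by rewrite mderivZ mderivXU kj scaler0.
Qed.

(** Moving the field past the Laplacian leaves a second-order operator with coefficients
    [2 * s j * M i j]. The hypothesis, infinitesimal invariance of the symbol, makes these
    antisymmetric in [i] and [j], while the twisted derivatives commute. *)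
Lemma vfield_lap M S s p :
  (forall i j, (j \in S)%:R * s j * M i j = - ((i \in S)%:R * s i * M j i)) ->
  vfield M (lap S s p) = lap S s (vfield M p).
Proof.
move=> Ms; rewrite /vfield /lap.
under eq_bigr => i _ do rewrite linear_sum mulr_sumr.
rewrite exchange_big /=.
have E j : sder j (sder j (\sum_i linf M i * sder i p)) =
  \sum_i (2 * M i j) *: sder j (sder i p) +
  \sum_i linf M i * sder i (sder j (sder j p)).
  rewrite !linear_sum -big_split /=; apply: eq_bigr => i _.
  rewrite sderM mderiv_linf [LHS]linearD /= !sderM mderivC mderiv_linf mul0r add0r.
  have -> : sder j (sder j (sder i p)) = sder i (sder j (sder j p)).
    by rewrite (sderC j i p) sderC.
  rewrite addrA; congr (_ + _).
  by rewrite !mul_mpolyC -scalerDl -mulr2n mulr_natl.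
under [RHS]eq_bigr do rewrite E scalerDr.
rewrite big_split /= [X in _ = X + _](_ : _ = 0) ?add0r; last first.
  set T := (X in X = 0).
  have TE : T = \sum_j \sum_i (2 * ((j \in S)%:R * s j * M i j)) *: sder j (sder i p).
    rewrite /T big_mkcond; apply: eq_bigr => j _.
    rewrite scaler_sumr; case: (j \in S); last first.
      by rewrite big1 // => i _; rewrite !mul0r mulr0 scale0r.
    by apply: eq_bigr => i _; rewrite scalerA mul1r mulrCA.
  have TN : T = - T.
    rewrite {1}TE exchange_big {1}TE -sumrN; apply: eq_bigr => i _.
    rewrite -sumrN; apply: eq_bigr => j _.
    by rewrite Ms mulrN scaleNr sderC.
  have : 2%:R *: T = 0 by rewrite scaler_nat mulr2n {1}TN addNr.
  by move/eqP; rewrite scaler_eq0 pnatr_eq0 /= => /eqP.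
apply: eq_bigr => j _; rewrite scaler_sumr; apply: eq_bigr => i _.
by rewrite linearZ /= -scalerAr.
Qed.

(** The chain rule for a linear substitution [G] turns second derivatives into this double sum; the
    hypothesis says that [G] preserves the symbol of the Laplacian. *)
Lemma lap_change (G : 'I_n -> 'I_n -> K) S s p :
  (forall i i', \sum_(j in S) s j * (G i j * G i' j) =
     if (i == i') && (i \in S) then s i else 0) ->
  \sum_(j in S) s j *: (\sum_i \sum_i' (G i j * G i' j) *: sder i' (sder i p))
  = lap S s p.
Proof.
move=> Gs; under eq_bigr => j _ do rewrite scaler_sumr.
rewrite exchange_big /= /lap [RHS]big_mkcond; apply: eq_bigr => i _.
under eq_bigr => j _ do rewrite scaler_sumr.
rewrite exchange_big /= (bigD1 i) //= [X in _ + X]big1 ?addr0.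
  under eq_bigr => j _ do rewrite scalerA.
  by rewrite -scaler_suml Gs eqxx; case: (i \in S); rewrite ?scale0r.
move=> i' /negPf i'i; under eq_bigr => j _ do rewrite scalerA.
by rewrite -scaler_suml Gs eq_sym i'i scale0r.
Qed.

Lemma mpoly_XUind (Q : P -> Prop) :
  (forall a, Q a%:MP) -> (forall i, Q 'X_i) ->
  (forall p q, Q p -> Q q -> Q (p + q)) ->
  (forall p q, Q p -> Q q -> Q (p * q)) -> forall p, Q p.
Proof.
move=> QC QX QD QM; have Q1 : Q 1 by rewrite -mpolyC1.
elim/mpolyind => [|a m p _ _ Qp]; first by rewrite -mpolyC0.
apply: (QD _ _ _ Qp); rewrite -mul_mpolyC; apply: (QM) => //.
rewrite mpolyXE_id; apply: big_ind => [||i _] //.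
by elim: (m i) => [|k IHk]; rewrite ?expr0 // exprS; exact: QM.
Qed.

End Weyl.

(** * Degree bounds; [msize] is the degree plus one for nonzero polynomials *)

Section Degree.
Variables (K : numFieldType) (n : nat).
Local Notation P := {mpoly K[n]}.
Implicit Types (p q : P) (i j : 'I_n).

Lemma msize_add d p q : (msize p <= d)%N -> (msize q <= d)%N -> (msize (p + q) <= d)%N.
Proof. by move=> pd qd; rewrite (leq_trans (msizeD_le _ _)) // geq_max pd. Qed.

Lemma msize_sub d p q : (msize p <= d)%N -> (msize q <= d)%N -> (msize (p - q) <= d)%N.
Proof. by move=> pd qd; rewrite msize_add // msizeN. Qed.

Lemma msize_scale d (a : K) p : (msize p <= d)%N -> (msize (a *: p) <= d)%N.
Proof. exact/leq_trans/msizeZ_le. Qed.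

Lemma msize_bigsum d (I : Type) (r : seq I) (Q : pred I) (F : I -> P) :
  (forall x, Q x -> (msize (F x) <= d)%N) -> (msize (\sum_(x <- r | Q x) F x) <= d)%N.
Proof.
move=> H; elim/big_ind: _ => // [|p q]; first by rewrite msize0.
exact: msize_add.
Qed.

Lemma msize_mul d e p q : (msize p <= d.+1)%N -> (msize q <= e)%N -> (msize (p * q) <= d + e)%N.
Proof.
have [->|p0] := eqVneq p 0; first by rewrite mul0r msize0.
have [->|q0] := eqVneq q 0; first by rewrite mulr0 msize0.
rewrite msizeM //; move: (msize p) (msize q) => a b; lia.
Qed.

Lemma msize_exp d p k : (msize p <= d.+1)%N -> (msize (p ^+ k) <= (d * k).+1)%N.
Proof.
move=> pd; elim: k => [|k IHk]; first by rewrite expr0 msize1 muln0.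
by rewrite exprS mulnS -addnS msize_mul.
Qed.

Lemma msize_XU i : (msize ('X_i : P) <= 2)%N.
Proof. by rewrite msizeX mdeg1. Qed.

Lemma msize_mderiv d i p : (msize p <= d.+1)%N -> (msize p^`M(i) <= d)%N.
Proof.
move=> pd; rewrite [p]mpolyE raddf_sum big_seq msize_bigsum // => m mp /=.
rewrite mderivZ msize_scale // mderivX; case: (posnP (m i)) => [->|mi].
  by rewrite scale0r msize0.
rewrite msize_scale // msizeX.
have E : m = ((m - U_(i)) + U_(i))%MM.
  by apply/mnmP => k; rewrite !mnmE; case: eqP => [<-|_]; rewrite /= ?subnK ?subn0 ?addn0.
have := leq_trans (msize_mdeg_lt mp) pd; rewrite {1}E mdegD mdeg1.
by rewrite addn1 ltnS.
Qed.

End Degree.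

Lemma msize_comp (K : numFieldType) (n m d : nat) (t : n.-tuple {mpoly K[m]}) (p : {mpoly K[n]}) :
  (forall i, msize (tnth t i) <= 2)%N -> (msize p <= d)%N ->
  (msize (p \mPo t) <= d)%N.
Proof.
move=> t2 pd; rewrite comp_mpolyE big_seq msize_bigsum // => e ep.
rewrite msize_scale //; apply: leq_trans (leq_trans (msize_mdeg_lt ep) pd).
rewrite mdegE; elim/big_ind2: _ => [|x a y b xa yb|i _]; first by rewrite msize1.
  by rewrite -addnS msize_mul.
by rewrite -{2}[e i]mul1n msize_exp.
Qed.

(** * Descent on the degree *)

Section Module.
Variables (K : numFieldType) (c iK : K).
Local Notation P := {mpoly K[7]}.
Implicit Types (p q : P).

(* Locking keeps unification from unfolding polynomials. *)
Definition mvar := locked (fun k : nat => 'X_(inord k) : P).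
Definition imagC : P := locked iK%:MP.
Definition cstC : P := locked c%:MP.
Definition sderk := locked (fun (k : nat) p => sder c (inord k) p : P).
Definition dvar := locked (fun (k : nat) p => p^`M(inord k) : P).

Local Notation x := mvar.
Local Notation J := imagC.
Local Notation C := cstC.
Local Notation D := sderk.
Local Notation d := dvar.

Lemma mvarE k : x k = 'X_(inord k). Proof. by rewrite /mvar -lock. Qed.
Lemma imagCE : J = iK%:MP. Proof. by rewrite /imagC -lock. Qed.
Lemma cstCE : C = c%:MP. Proof. by rewrite /cstC -lock. Qed.
Lemma sderkE k p : D k p = sder c (inord k) p. Proof. by rewrite /sderk -lock. Qed.
Lemma dvarE k p : d k p = p^`M(inord k). Proof. by rewrite /dvar -lock. Qed.

Definition quad0 : P := x 0 ^+ 2 + x 1 ^+ 2 - x 2 ^+ 2.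
Definition quad1 : P := x 3 ^+ 2 + x 4 ^+ 2 - x 5 ^+ 2 - x 6 ^+ 2.
Definition lap0 p : P := D 0 (D 0 p) + D 1 (D 1 p) - D 2 (D 2 p).
Definition lap1 p : P := D 3 (D 3 p) + D 4 (D 4 p) - D 5 (D 5 p) - D 6 (D 6 p).
(* 8 wyv *)
Definition cub : P :=
  x 0 * (x 3 ^+ 2 - x 4 ^+ 2 - x 5 ^+ 2 + x 6 ^+ 2)
  + 2%:R * x 1 * (x 3 * x 4 - x 5 * x 6) + 2%:R * x 2 * (x 4 * x 5 - x 3 * x 6).

(* z_+, z_-, zeta, z'_+, z'_-, zeta'_+, zeta'_-, with coordinates in place of
   the variables of the Fock space. *)
Definition zp : P := x 0 + J * x 1.
Definition zm : P := x 0 - J * x 1.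
Definition ze : P := x 2.
Definition ap : P := x 3 + J * x 4.
Definition am : P := x 3 - J * x 4.
Definition bp : P := x 5 + J * x 6.
Definition bm : P := x 5 - J * x 6.

(** The reflection diag(1, -1) in coordinates: it negates the off-diagonal entries of y and the
    second entries of v and w. *)
Definition refl_sub : 7.-tuple P :=
  [tuple x 0; - x 1; - x 2; x 3; - x 4; x 5; - x 6].

(* The last three fields control leading terms only: lower terms are absorbed
   by the induction on the degree. *)
Record closed_submodule (M : P -> Prop) : Prop := ClosedSubmodule {
  clD : forall p q, M p -> M q -> M (p + q);
  clZ : forall a p, M p -> M (a *: p);
  cl_quad0 : forall p, M p -> M (quad0 * p);
  cl_quad1 : forall p, M p -> M (quad1 * p);
  cl_lap0 : forall p, M p -> M (lap0 p);
  cl_lap1 : forall p, M p -> M (lap1 p);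
  cl_cub : forall p, M p -> M (cub * p);
  cl_rot : forall p, M (2%:R * (x 0 * D 1 p - x 1 * D 0 p)
     + (x 3 * D 4 p - x 4 * D 3 p) + (x 5 * D 6 p - x 6 * D 5 p));
  cl_scal : forall p, M (x 5 * D 3 p + x 3 * D 5 p + x 6 * D 4 p + x 4 * D 6 p);
  cl_diag : forall p, M (- 2%:R * (x 2 * D 1 p + x 1 * D 2 p)
     + (x 5 * D 3 p + x 3 * D 5 p) - (x 6 * D 4 p + x 4 * D 6 p));
  cl_symm : forall p, M (2%:R * (x 2 * D 0 p + x 0 * D 2 p)
     + (x 6 * D 3 p + x 3 * D 6 p) + (x 5 * D 4 p + x 4 * D 5 p));
  cl_refl : forall p, M (p \mPo refl_sub + p);
  cl_ze : exists a r, [/\ a != 0, (msize r <= 1)%N & M (a *: ze + r)];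
  cl_zpam : exists a r, [/\ a != 0, (msize r <= 3)%N & M (a *: (zp * am ^+ 2) + r)];
  cl_zpbm : exists a r, [/\ a != 0, (msize r <= 3)%N & M (a *: (zp * bm ^+ 2) + r)]
}.

Hypotheses (c0 : c != 0) (iK2 : iK * iK = -1).
Variable M : P -> Prop.
Hypothesis HM : closed_submodule M.

Lemma imagC_sqr : J * J = -1.
Proof. by rewrite imagCE -mpolyCM iK2 mpolyCN. Qed.

Lemma cl0 : M 0.
Proof. by rewrite -(scale0r (0 \mPo refl_sub + 0)); apply/(clZ HM)/(cl_refl HM). Qed.

Lemma clN p : M p -> M (- p).
Proof. by rewrite -scaleN1r; apply: (clZ HM). Qed.

Lemma clB p q : M p -> M q -> M (p - q).
Proof. by move=> Mp Mq; apply: (clD HM) => //; apply: clN. Qed.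

Lemma clC a p : M p -> M (a%:MP * p).
Proof. by rewrite mul_mpolyC; apply: (clZ HM). Qed.

Lemma clJ p : M p -> M (J * p).
Proof. by rewrite imagCE; apply: clC. Qed.

Lemma cln k p : M p -> M (k%:R * p).
Proof. by rewrite -mpolyC_nat; apply: clC. Qed.

Lemma clZ_inv a p : a != 0 -> M (a *: p) -> M p.
Proof. by move=> a0 /(clZ HM a^-1); rewrite scalerA mulVf // scale1r. Qed.

Lemma clC_inv a p : a != 0 -> M (a%:MP * p) -> M p.
Proof. by rewrite mul_mpolyC; apply: clZ_inv. Qed.

Lemma cln_inv k p : M (k.+1%:R * p) -> M p.
Proof. by rewrite -mpolyC_nat; apply: clC_inv; rewrite pnatr_eq0. Qed.

Lemma cl_addr p q : M q -> M (p + q) -> M p.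
Proof. by move=> Mq Mpq; rewrite -[p](addrK q); apply: clB. Qed.

Lemma clCc p : M p -> M (C * p).
Proof. by rewrite cstCE; apply: clC. Qed.

Lemma clCc_inv p : M (C * p) -> M p.
Proof. by rewrite cstCE; apply: clC_inv. Qed.

Lemma sderk_dvar k p : D k p = d k p - C * x k * p.
Proof. by rewrite sderkE dvarE cstCE mvarE /sder -mul_mpolyC mulrA. Qed.

Lemma dvarD k p q : d k (p + q) = d k p + d k q. Proof. by rewrite !dvarE mderivD. Qed.
Lemma dvarN k p : d k (- p) = - d k p. Proof. by rewrite !dvarE mderivN. Qed.
Lemma dvarM k p q : d k (p * q) = d k p * q + p * d k q.
Proof. by rewrite !dvarE mderivM. Qed.
Lemma dvar_imagC k : d k J = 0. Proof. by rewrite dvarE imagCE mderivC. Qed.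
Lemma dvar_cstC k : d k C = 0. Proof. by rewrite dvarE cstCE mderivC. Qed.
Lemma dvar_nat k m : d k m%:R = 0. Proof. by rewrite -mpolyC_nat dvarE mderivC. Qed.
Lemma dvar1 k : d k 1 = 0. Proof. exact: (dvar_nat k 1). Qed.
Lemma dvarX k l : (k < 7)%N -> (l < 7)%N -> d k (x l) = (l == k)%:R.
Proof. by move=> k7 l7; rewrite dvarE mvarE mderivXU -val_eqE /= !inordK. Qed.
Lemma dvarXX k : (k < 7)%N -> d k (x k) = 1.
Proof. by move=> k7; rewrite dvarX // eqxx. Qed.

Lemma sderkD k p q : D k (p + q) = D k p + D k q. Proof. by rewrite !sderkE linearD. Qed.
Lemma sderkB k p q : D k (p - q) = D k p - D k q. Proof. by rewrite !sderkE linearB. Qed.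

Lemma sderk_sderk k p : (k < 7)%N ->
  D k (D k p) = d k (d k p) - 2%:R * C * x k * d k p - C * p + C * C * (x k * x k) * p.
Proof.
by move=> k7; rewrite !sderk_dvar dvarD dvarN !dvarM dvar_cstC dvarXX //; ring.
Qed.

Lemma sderk_sqr k p : (k < 7)%N ->
  D k (D k (x k ^+ 2 * p)) = x k ^+ 2 * D k (D k p) + 4%:R * (x k * D k p) + 2%:R * p.
Proof.
move=> k7; rewrite !sderk_sderk // expr2 -mulrA.
have E q : d k (x k * q) = q + x k * d k q by rewrite dvarM dvarXX // mul1r.
by rewrite !(E, dvarD) sderk_dvar; ring.
Qed.

Lemma sderk_mvar k l p : (k < 7)%N -> (l < 7)%N -> l != k ->
  D k (x l * p) = x l * D k p.
Proof. by move=> k7 l7 /negPf lk; rewrite !sderk_dvar dvarM dvarX // lk mul0r; ring. Qed.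

(* [lap, q] is the Euler operator up to constants. *)
Lemma cl_euler0 p : M p -> M (x 0 * D 0 p + x 1 * D 1 p + x 2 * D 2 p).
Proof.
move=> Mp; have := clB (cl_lap0 HM (cl_quad0 HM Mp)) (cl_quad0 HM (cl_lap0 HM Mp)).
(* Each variable contributes 4 x D + 2, its sign in [lap0] cancelling the one in [quad0]. *)
have -> : lap0 (quad0 * p) - quad0 * lap0 p =
    4%:R * (x 0 * D 0 p + x 1 * D 1 p + x 2 * D 2 p) + 6%:R * p.
  have DD k : D k (D k (quad0 * p)) =
     D k (D k (x 0 ^+ 2 * p)) + D k (D k (x 1 ^+ 2 * p)) - D k (D k (x 2 ^+ 2 * p)).
    by rewrite /quad0 mulrBl mulrDl !(sderkB, sderkD).
  rewrite /lap0 !DD !sderk_sqr // !expr2 -!mulrA !sderk_mvar // /quad0; ring.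
by move/(cl_addr (cln _ Mp))/cln_inv.
Qed.

Lemma cl_euler1 p : M p -> M (x 3 * D 3 p + x 4 * D 4 p + x 5 * D 5 p + x 6 * D 6 p).
Proof.
move=> Mp; have := clB (cl_lap1 HM (cl_quad1 HM Mp)) (cl_quad1 HM (cl_lap1 HM Mp)).
have -> : lap1 (quad1 * p) - quad1 * lap1 p =
    4%:R * (x 3 * D 3 p + x 4 * D 4 p + x 5 * D 5 p + x 6 * D 6 p) + 8%:R * p.
  have DD k : D k (D k (quad1 * p)) =
     D k (D k (x 3 ^+ 2 * p)) + D k (D k (x 4 ^+ 2 * p)) - D k (D k (x 5 ^+ 2 * p))
      - D k (D k (x 6 ^+ 2 * p)).
    by rewrite /quad1 !mulrBl mulrDl !(sderkB, sderkD).
  rewrite /lap1 !DD !sderk_sqr // !expr2 -!mulrA !sderk_mvar // /quad1; ring.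
by move/(cl_addr (cln _ Mp))/cln_inv.
Qed.

Lemma cl_number0 p : M p ->
  M (2%:R * C * (x 0 * d 0 p + x 1 * d 1 p - x 2 * d 2 p)
     - (d 0 (d 0 p) + d 1 (d 1 p) - d 2 (d 2 p))).
Proof.
move=> Mp; have := clB (clCc (clCc (cl_quad0 HM Mp))) (cl_lap0 HM Mp).
(* The terms [- C * p] of the three second derivatives carry signs with sum 1, hence this
   correction; in the block of four variables they cancel. *)
move/clB/(_ (clCc Mp)); rewrite /lap0 !sderk_sderk //.
by congr M; rewrite /quad0; ring.
Qed.

Lemma cl_number1 p : M p ->
  M (2%:R * C * (x 3 * d 3 p + x 4 * d 4 p - x 5 * d 5 p - x 6 * d 6 p)
     - (d 3 (d 3 p) + d 4 (d 4 p) - d 5 (d 5 p) - d 6 (d 6 p))).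
Proof.
move=> Mp; have := clB (clCc (clCc (cl_quad1 HM Mp))) (cl_lap1 HM Mp).
rewrite /lap1 !sderk_sderk //.
by congr M; rewrite /quad1; ring.
Qed.

Ltac deriv := rewrite ?expr2 ?(dvarD, dvarN, dvarM, dvar_nat) ?dvarX //=; ring.

(* [C ^+ 2 * q - lap] is, up to a constant, [2 * C] times a number operator;
   these operators separate the components of [cub * ze]. *)
Lemma cl_commutator : M ze -> M (x 4 * x 5 - x 3 * x 6).
Proof.
move=> Mz; set A := x 4 * x 5 - x 3 * x 6.
pose Y := x 2 * (x 0 * (x 3 * x 3 - x 4 * x 4 - x 5 * x 5 + x 6 * x 6)
  + 2%:R * (x 1 * (x 3 * x 4 - x 5 * x 6))).
pose Y' := x 2 * (x 0 * (x 3 * x 3 - x 4 * x 4 + x 5 * x 5 - x 6 * x 6)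
  + 2%:R * (x 1 * (x 3 * x 4 + x 5 * x 6))).
(* One has [cub * ze] = Y + 2 x_2^2 A. The Euler part of the first number operator kills Y and has
   eigenvalue -2 on x_2^2 A. Adding 4 C times [cub * ze] cancels x_2^2 A, and the second derivative
   in x_2 leaves 4 A. *)
have MU : M (A + C * Y).
  have Mcz := cl_cub HM Mz; have := cl_number0 Mcz.
  have E0 : d 0 (cub * ze) = x 2 * (x 3 * x 3 - x 4 * x 4 - x 5 * x 5 + x 6 * x 6).
    by rewrite /cub /ze; deriv.
  have E1 : d 1 (cub * ze) = x 2 * (2%:R * (x 3 * x 4 - x 5 * x 6)).
    by rewrite /cub /ze; deriv.
  have E2 : d 2 (cub * ze) = x 0 * (x 3 * x 3 - x 4 * x 4 - x 5 * x 5 + x 6 * x 6)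
     + 2%:R * (x 1 * (x 3 * x 4 - x 5 * x 6)) + 4%:R * (x 2 * (x 4 * x 5 - x 3 * x 6)).
    by rewrite /cub /ze; deriv.
  rewrite E0 E1 E2.
  have -> : d 0 (x 2 * (x 3 * x 3 - x 4 * x 4 - x 5 * x 5 + x 6 * x 6)) = 0 by deriv.
  have -> : d 1 (x 2 * (2%:R * (x 3 * x 4 - x 5 * x 6))) = 0 by deriv.
  have -> : d 2 (x 0 * (x 3 * x 3 - x 4 * x 4 - x 5 * x 5 + x 6 * x 6)
     + 2%:R * (x 1 * (x 3 * x 4 - x 5 * x 6)) + 4%:R * (x 2 * (x 4 * x 5 - x 3 * x 6)))
     = 4%:R * A by rewrite /A; deriv.
  move/(clD HM)/(_ (cln 4 (clCc Mcz))) => H; apply: (@cln_inv 3).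
  move: H; congr M; rewrite /cub /ze /Y /A; ring.
(* The second number operator kills A, which is linear in (x_3, x_4) and in (x_5, x_6). The
   components of Y quadratic in one of these pairs are harmonic and are scaled with opposite signs,
   so up to constants the operator exchanges Y and Y'. This removes Y from A + C Y. *)
have MY' : M Y'.
  have := cl_number1 MU.
  have E3 : d 3 (A + C * Y) = - x 6 + C * (x 2 * (2%:R * (x 0 * x 3 + x 1 * x 4))).
    by rewrite /A /Y !(dvarD, dvarN, dvarM, dvar_nat, dvar_cstC) !dvarX //=; ring.
  have E4 : d 4 (A + C * Y) = x 5 + C * (x 2 * (2%:R * (x 1 * x 3 - x 0 * x 4))).
    by rewrite /A /Y !(dvarD, dvarN, dvarM, dvar_nat, dvar_cstC) !dvarX //=; ring.
  have E5 : d 5 (A + C * Y) = x 4 - C * (x 2 * (2%:R * (x 0 * x 5 + x 1 * x 6))).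
    by rewrite /A /Y !(dvarD, dvarN, dvarM, dvar_nat, dvar_cstC) !dvarX //=; ring.
  have E6 : d 6 (A + C * Y) = - x 3 + C * (x 2 * (2%:R * (x 0 * x 6 - x 1 * x 5))).
    by rewrite /A /Y !(dvarD, dvarN, dvarM, dvar_nat, dvar_cstC) !dvarX //=; ring.
  rewrite E3 E4 E5 E6 !(dvarD, dvarN, dvarM, dvar_nat, dvar_cstC) !dvarX //= => H.
  do 2!apply: clCc_inv; apply: (@cln_inv 3).
  by move: H; congr M; rewrite /Y'; ring.
have MY : M Y.
  have := cl_number1 MY'.
  have E3 : d 3 Y' = x 2 * (2%:R * (x 0 * x 3 + x 1 * x 4)).
    by rewrite /Y' !(dvarD, dvarN, dvarM, dvar_nat, dvar_cstC) !dvarX //=; ring.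
  have E4 : d 4 Y' = x 2 * (2%:R * (x 1 * x 3 - x 0 * x 4)).
    by rewrite /Y' !(dvarD, dvarN, dvarM, dvar_nat, dvar_cstC) !dvarX //=; ring.
  have E5 : d 5 Y' = x 2 * (2%:R * (x 0 * x 5 + x 1 * x 6)).
    by rewrite /Y' !(dvarD, dvarN, dvarM, dvar_nat, dvar_cstC) !dvarX //=; ring.
  have E6 : d 6 Y' = x 2 * (2%:R * (x 1 * x 5 - x 0 * x 6)).
    by rewrite /Y' !(dvarD, dvarN, dvarM, dvar_nat, dvar_cstC) !dvarX //=; ring.
  rewrite E3 E4 E5 E6 !(dvarD, dvarN, dvarM, dvar_nat, dvar_cstC) !dvarX //= => H.
  apply: clCc_inv; apply: (@cln_inv 3).
  by move: H; congr M; rewrite /Y; ring.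
by apply: cl_addr MU; apply: clCc.
Qed.

End Module.

(** * Reduction of monomials of degree [n] modulo lower degree *)

Section Descent.
Variables (K : numFieldType) (c iK : K).
Local Notation P := {mpoly K[7]}.
Implicit Types (p q : P).
Local Notation x := (@mvar K).
Local Notation J := (@imagC K iK).
Local Notation d := (@dvar K).
Local Notation zp := (@zp K iK).
Local Notation zm := (@zm K iK).
Local Notation ze := (@ze K).
Local Notation ap := (@ap K iK).
Local Notation am := (@am K iK).
Local Notation bp := (@bp K iK).
Local Notation bm := (@bm K iK).
Local Notation refl_sub := (@refl_sub K).
Hypotheses (c0 : c != 0) (iK2 : iK * iK = -1).
Variable M : P -> Prop.
Hypothesis HM : closed_submodule c iK M.

Local Notation clN := (clN HM).
Local Notation clB := (clB HM).
Local Notation clCc := (clCc HM).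
Local Notation clCc_inv := (clCc_inv c0 HM).
Local Notation cl_addr := (cl_addr HM).
Local Notation clJ := (clJ HM).
Local Notation cln := (cln HM).
Local Notation cln_inv := (cln_inv HM).
Local Notation JJ := (imagC_sqr iK2).

(** The factors are eigenvectors of rotations, of weights 2, -2, 0, 1, -1, 1, -1. The reflection
    exchanges primed and unprimed exponents, up to the sign from zeta. *)
Definition mon (a a' e b b' f f' : nat) : P :=
  zp ^+ a * zm ^+ a' * ze ^+ e * ap ^+ b * am ^+ b' * bp ^+ f * bm ^+ f'.

Definition rot p : P := 2%:R * (x 0 * d 1 p - x 1 * d 0 p)
     + (x 3 * d 4 p - x 4 * d 3 p) + (x 5 * d 6 p - x 6 * d 5 p).

(** The Gaussian is rotation invariant, so the twists in the derivatives cancel. The relation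
    preserves the degree and is diagonal on the monomials [mon]. *)
Lemma cl_rotation p : M (rot p).
Proof.
by have := cl_rot HM p; congr M; rewrite /rot !sderk_dvar; ring.
Qed.

Lemma rotM p q : rot (p * q) = rot p * q + p * rot q.
Proof. by rewrite /rot !dvarM; ring. Qed.

Lemma rot_eigM p q (w w' : P) : rot p = w * p -> rot q = w' * q ->
  rot (p * q) = (w + w') * (p * q).
Proof. by move=> pw qw; rewrite rotM pw qw; ring. Qed.

Lemma rot_eigX k p (w : P) : rot p = w * p -> rot (p ^+ k) = (k%:R * w) * p ^+ k.
Proof.
move=> pw; elim: k => [|k IHk].
  by rewrite expr0 !mul0r /rot !dvar1; ring.
by rewrite exprS (rot_eigM pw IHk) -natr1; ring.
Qed.

Lemma rot_mon a a' e b b' f f' : rot (mon a a' e b b' f f') =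
  ((2 * a + b + f)%:R - (2 * a' + b' + f')%:R) * (J * mon a a' e b b' f f').
Proof.
have Ezp : rot zp = (2%:R * J) * zp.
  by rewrite /rot /zp !(dvarD, dvarM, dvar_imagC) !dvarX //=; ring: JJ.
have Ezm : rot zm = - (2%:R * J) * zm.
  by rewrite /rot /zm !(dvarD, dvarN, dvarM, dvar_imagC) !dvarX //=; ring: JJ.
have Eze : rot ze = 0 * ze.
  by rewrite /rot /ze !dvarX //=; ring.
have Eap : rot ap = J * ap.
  by rewrite /rot /ap !(dvarD, dvarM, dvar_imagC) !dvarX //=; ring: JJ.
have Eam : rot am = - J * am.
  by rewrite /rot /am !(dvarD, dvarN, dvarM, dvar_imagC) !dvarX //=; ring: JJ.
have Ebp : rot bp = J * bp.
  by rewrite /rot /bp !(dvarD, dvarM, dvar_imagC) !dvarX //=; ring: JJ.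
have Ebm : rot bm = - J * bm.
  by rewrite /rot /bm !(dvarD, dvarN, dvarM, dvar_imagC) !dvarX //=; ring: JJ.
rewrite (rot_eigM (rot_eigM (rot_eigM (rot_eigM (rot_eigM (rot_eigM (rot_eigX a Ezp)
  (rot_eigX a' Ezm)) (rot_eigX e Eze)) (rot_eigX b Eap)) (rot_eigX b' Eam))
  (rot_eigX f Ebp)) (rot_eigX f' Ebm)).
rewrite -/(mon a a' e b b' f f') !mul2n -!addnn !natrD; ring.
Qed.

Lemma mon_comp_refl a a' e b b' f f' :
  mon a a' e b b' f f' \mPo refl_sub = (-1) ^+ e * mon a' a e b' b f' f.
Proof.
have X k : (k < 7)%N -> x k \mPo refl_sub = refl_sub`_k.
  by move=> k7; rewrite mvarE comp_mpolyXU inordK.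
have XJ : J \mPo refl_sub = J by rewrite imagCE comp_mpolyC.
rewrite /mon !rmorphM !rmorphXn /= /zp /zm /ze /ap /am /bp /bm.
rewrite !(rmorphD, rmorphN, rmorphM) /= XJ !X //= !mulrN !opprK (exprNn (x 2)).
move: ((-1) ^+ e) (x 2 ^+ e) (_ ^+ a) (_ ^+ a') (_ ^+ b) (_ ^+ b') (_ ^+ f) (_ ^+ f').
by move=> *; ring.
Qed.

Lemma msize_x k : (msize (x k) <= 2)%N.
Proof. by rewrite mvarE msize_XU. Qed.

Lemma msize_xJx k l : (msize (x k + J * x l) <= 2)%N /\ (msize (x k - J * x l) <= 2)%N.
Proof.
have H : (msize (J * x l) <= 2)%N.
  by rewrite imagCE mul_mpolyC msize_scale // msize_x.
by split; [apply: msize_add | apply: msize_sub] => //; apply: msize_x.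
Qed.

Lemma msize_mon a a' e b b' f f' :
  (msize (mon a a' e b b' f f') <= (a + a' + e + b + b' + f + f').+1)%N.
Proof.
have X k p : (msize p <= 2)%N -> (msize (p ^+ k) <= k.+1)%N.
  by move=> p2; have := msize_exp k (p2 : (msize p <= 1.+1)%N); rewrite mul1n.
have [zp2 zm2] := msize_xJx 0 1; have [ap2 am2] := msize_xJx 3 4.
have [bp2 bm2] := msize_xJx 5 6; have ze2 := msize_x 2.
by rewrite /mon; do 6![rewrite -addnS; apply: msize_mul; last exact: X]; apply: X.
Qed.

Lemma msize_xd m k l q : (msize q <= m)%N -> (msize (x k * d l q) <= m)%N.
Proof.
case: m => [|m].
  rewrite leqn0 msize_poly_eq0 => /eqP->.
  by rewrite dvarE mderiv0 mulr0 msize0.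
move=> qm; rewrite -(add1n m) msize_mul ?msize_x //.
by rewrite dvarE msize_mderiv.
Qed.

(** Induction hypothesis of the descent: everything of degree below [n] is settled. The lemmas
    [mon_*] that follow and fix the sum of the exponents treat degree exactly [n]. *)
Variable n : nat.
Hypothesis low : forall p, (msize p <= n)%N -> M p.

Lemma low_xd k l q : (msize q <= n)%N -> M (x k * d l q).
Proof. by move=> qn; apply/low/msize_xd. Qed.

Lemma cl_sq012 q : (msize q <= n)%N -> M ((x 0 * x 0 + x 1 * x 1 + x 2 * x 2) * q).
Proof.
move=> qn; apply: clCc_inv.
have H := cl_euler0 HM (low qn).
have L := clD HM (clD HM (low_xd 0 0 qn) (low_xd 1 1 qn)) (low_xd 2 2 qn).
by have := clB L H; congr M; rewrite !sderk_dvar; ring.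
Qed.

Lemma cl_sq3456 q : (msize q <= n)%N ->
  M ((x 3 * x 3 + x 4 * x 4 + x 5 * x 5 + x 6 * x 6) * q).
Proof.
move=> qn; apply: clCc_inv.
have H := cl_euler1 HM (low qn).
have L := clD HM (clD HM (clD HM (low_xd 3 3 qn) (low_xd 4 4 qn)) (low_xd 5 5 qn)) (low_xd 6 6 qn).
by have := clB L H; congr M; rewrite !sderk_dvar; ring.
Qed.

Lemma cl_zpzm q : (msize q <= n)%N -> M (zp * zm * q).
Proof.
move=> qn; apply: (@cln_inv 1).
have := clD HM (cl_sq012 qn) (cl_quad0 HM (low qn)).
by congr M; rewrite /quad0 /zp /zm; ring: JJ.
Qed.

Lemma cl_zeze q : (msize q <= n)%N -> M (ze * ze * q).
Proof.
move=> qn; apply: (@cln_inv 1).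
have := clB (cl_sq012 qn) (cl_quad0 HM (low qn)).
by congr M; rewrite /quad0 /ze; ring.
Qed.

Lemma cl_apam q : (msize q <= n)%N -> M (ap * am * q).
Proof.
move=> qn; apply: (@cln_inv 1).
have := clD HM (cl_sq3456 qn) (cl_quad1 HM (low qn)).
by congr M; rewrite /quad1 /ap /am; ring: JJ.
Qed.

Lemma cl_bpbm q : (msize q <= n)%N -> M (bp * bm * q).
Proof.
move=> qn; apply: (@cln_inv 1).
have := clB (cl_sq3456 qn) (cl_quad1 HM (low qn)).
by congr M; rewrite /quad1 /bp /bm; ring: JJ.
Qed.

(** The relation of the scalar matrices, which dilate v against w. Its top term is a multiple of
    |w|^2 - |v|^2 = x_3 x_5 + x_4 x_6. *)
Lemma cl_apbm q : (msize q <= n)%N -> M ((ap * bm + am * bp) * q).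
Proof.
move=> qn; apply: clCc_inv.
have L := clD HM (clD HM (low_xd 5 3 qn) (low_xd 3 5 qn)) (clD HM (low_xd 6 4 qn) (low_xd 4 6 qn)).
have := clB L (cl_scal HM q).
by congr M; rewrite !sderk_dvar /ap /am /bp /bm; ring: JJ.
Qed.

Lemma cl_diag_top q : (msize q <= n)%N ->
  M ((x 3 * x 5 - x 4 * x 6 - 2%:R * x 1 * x 2) * q).
Proof.
move=> qn; do [apply: clCc_inv; apply: (@cln_inv 1)].
have L1 := clD HM (low_xd 2 1 qn) (low_xd 1 2 qn).
have L2 := clD HM (low_xd 5 3 qn) (low_xd 3 5 qn).
have L3 := clD HM (low_xd 6 4 qn) (low_xd 4 6 qn).
have L := clB (clB L2 L3) (cln 2 L1).
have := clB L (cl_diag HM q).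
by congr M; rewrite !sderk_dvar; ring.
Qed.

Lemma cl_symm_top q : (msize q <= n)%N ->
  M ((x 3 * x 6 + x 4 * x 5 + 2%:R * x 0 * x 2) * q).
Proof.
move=> qn; do [apply: clCc_inv; apply: (@cln_inv 1)].
have L1 := clD HM (low_xd 2 0 qn) (low_xd 0 2 qn).
have L2 := clD HM (low_xd 6 3 qn) (low_xd 3 6 qn).
have L3 := clD HM (low_xd 5 4 qn) (low_xd 4 5 qn).
have L := clD HM (clD HM L2 L3) (cln 2 L1).
have := clB L (cl_symm HM q).
by congr M; rewrite !sderk_dvar; ring.
Qed.

(** Traceless symmetric matrices have weights 2 and -2 under rotations; combining the diagonal and
    the off-diagonal relation with coefficient [J] or [- J] isolates one weight. *)
Lemma cl_apbp q : (msize q <= n)%N -> M ((ap * bp + 2%:R * J * zp * ze) * q).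
Proof.
move=> qn; have := clD HM (cl_diag_top qn) (clJ (cl_symm_top qn)).
by congr M; rewrite /ap /bp /zp /ze; ring: JJ.
Qed.

Lemma cl_ambm q : (msize q <= n)%N -> M ((am * bm - 2%:R * J * zm * ze) * q).
Proof.
move=> qn; have := clB (cl_diag_top qn) (clJ (cl_symm_top qn)).
by congr M; rewrite /am /bm /zm /ze; ring: JJ.
Qed.

(** The first factor is 16 wyv written in the rotation eigenvectors. *)
Lemma cl_wyv q : (msize q <= n)%N ->
  M ((zm * (ap ^+ 2 - bp ^+ 2) + zp * (am ^+ 2 - bm ^+ 2)
     + 2%:R * J * ze * (am * bp - ap * bm)) * q).
Proof.
move=> qn; have := cln 2 (cl_cub HM (low qn)).
by congr M; rewrite /cub /ap /am /bp /bm /zp /zm /ze; ring: JJ.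
Qed.

Lemma mon_low a a' e b b' f f' : (a + a' + e + b + b' + f + f' < n)%N ->
  (msize (mon a a' e b b' f f') <= n)%N.
Proof. exact/leq_trans/msize_mon. Qed.

Lemma mon_zpzm a a' e b b' f f' : (a.+1 + a'.+1 + e + b + b' + f + f' = n)%N ->
  M (mon a.+1 a'.+1 e b b' f f').
Proof.
move=> sn; have -> : mon a.+1 a'.+1 e b b' f f' = zp * zm * mon a a' e b b' f f'.
  by rewrite /mon !exprS; ring.
by apply/cl_zpzm/mon_low; lia.
Qed.

Lemma mon_zeze a a' e b b' f f' : (a + a' + e.+2 + b + b' + f + f' = n)%N ->
  M (mon a a' e.+2 b b' f f').
Proof.
move=> sn; have -> : mon a a' e.+2 b b' f f' = ze * ze * mon a a' e b b' f f'.
  by rewrite /mon !exprS; ring.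
by apply/cl_zeze/mon_low; lia.
Qed.

Lemma mon_apam a a' e b b' f f' : (a + a' + e + b.+1 + b'.+1 + f + f' = n)%N ->
  M (mon a a' e b.+1 b'.+1 f f').
Proof.
move=> sn; have -> : mon a a' e b.+1 b'.+1 f f' = ap * am * mon a a' e b b' f f'.
  by rewrite /mon !exprS; ring.
by apply/cl_apam/mon_low; lia.
Qed.

Lemma mon_bpbm a a' e b b' f f' : (a + a' + e + b + b' + f.+1 + f'.+1 = n)%N ->
  M (mon a a' e b b' f.+1 f'.+1).
Proof.
move=> sn; have -> : mon a a' e b b' f.+1 f'.+1 = bp * bm * mon a a' e b b' f f'.
  by rewrite /mon !exprS; ring.
by apply/cl_bpbm/mon_low; lia.
Qed.

Lemma mon_weight a a' e b b' f f' : (2 * a + b + f != 2 * a' + b' + f')%N ->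
  M (mon a a' e b b' f f').
Proof.
move=> w; have := cl_rotation (mon a a' e b b' f f'); rewrite rot_mon.
have -> : forall u v : nat, u%:R - v%:R = (u%:R - v%:R : K)%:MP :> P.
  by move=> u v; rewrite mpolyCB !mpolyC_nat.
move/(clC_inv HM); rewrite subr_eq0 eqr_nat => /(_ w) /clJ.
by rewrite mulrA JJ mulN1r => /clN; rewrite opprK.
Qed.

Lemma mon_refl a a' e b b' f f' :
  M (mon a' a e b' b f' f) -> M (mon a a' e b b' f f').
Proof.
move=> H; have := cl_refl HM (mon a' a e b' b f' f); rewrite mon_comp_refl.
move/(cl_addr H); rewrite -signr_odd; case: (odd e); rewrite ?mul1r //.
by rewrite mulN1r => /clN; rewrite opprK.
Qed.

(** In weight zero without [zm], trade [zp * ze] for [ap * bp]. The weight forces a factor [am] or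
    [bm], which pairs with the new [ap] or [bp]. *)
Lemma mon_zpze a a' e b b' f f' : (a.+1 + a' + e.+1 + b + b' + f + f' = n)%N ->
  M (mon a.+1 a' e.+1 b b' f f').
Proof.
move=> sn; have [w|] := boolP (2 * a.+1 + b + f != 2 * a' + b' + f')%N.
  exact: mon_weight.
rewrite negbK => /eqP w.
case: a' => [|a'] in sn w *; last exact: mon_zpzm.
have q_low : (msize (mon a 0 e b b' f f') <= n)%N by apply: mon_low; lia.
have H : M (2%:R * (J * mon a.+1 0 e.+1 b b' f f')).
  have := cl_apbp q_low.
  have -> : (ap * bp + 2%:R * J * zp * ze) * mon a 0 e b b' f f' =
     2%:R * (J * mon a.+1 0 e.+1 b b' f f') + mon a 0 e b.+1 b' f.+1 f'.
    by rewrite /mon !exprS; ring.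
  apply: cl_addr.
  case: b' => [|b'] in sn w q_low *; last by apply: mon_apam; lia.
  case: f' => [|f'] in sn w q_low *; first by lia.
  by apply: mon_bpbm; lia.
by move/(@cln_inv 1)/clJ : H; rewrite mulrA JJ mulN1r => /clN; rewrite opprK.
Qed.

(** Here [am * bm] is traded for [zm * ze], and the new [zm] pairs with [zp]. *)
Lemma mon_zpambm a b b' f f' : (a.+1 + 0 + 0 + b + b'.+1 + f + f'.+1 = n)%N ->
  M (mon a.+1 0 0 b b'.+1 f f'.+1).
Proof.
move=> sn; have q_low : (msize (mon a.+1 0 0 b b' f f') <= n)%N by apply: mon_low; lia.
have := cl_ambm q_low.
have -> : (am * bm - 2%:R * J * zm * ze) * mon a.+1 0 0 b b' f f' =
   mon a.+1 0 0 b b'.+1 f f'.+1 - 2%:R * (J * mon a.+1 1 1 b b' f f').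
  by rewrite /mon !exprS; ring.
apply: cl_addr; apply: clN; apply: cln; apply: clJ; apply: mon_zpzm; lia.
Qed.

Lemma mon_ambp a a' e b b' f f' : (a + a' + e + b + b'.+1 + f.+1 + f' = n)%N ->
  M (mon a a' e b.+1 b' f f'.+1) -> M (mon a a' e b b'.+1 f.+1 f').
Proof.
move=> sn; have q_low : (msize (mon a a' e b b' f f') <= n)%N by apply: mon_low; lia.
have := cl_apbm q_low.
have -> : (ap * bm + am * bp) * mon a a' e b b' f f' =
   mon a a' e b b'.+1 f.+1 f' + mon a a' e b.+1 b' f f'.+1.
  by rewrite /mon !exprS; ring.
by move=> H H'; apply: cl_addr H' H.
Qed.

Lemma mon_apbm a a' e b b' f f' : (a + a' + e + b.+1 + b' + f + f'.+1 = n)%N ->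
  M (mon a a' e b b'.+1 f.+1 f') -> M (mon a a' e b.+1 b' f f'.+1).
Proof.
move=> sn; have q_low : (msize (mon a a' e b b' f f') <= n)%N by apply: mon_low; lia.
have := cl_apbm q_low.
have -> : (ap * bm + am * bp) * mon a a' e b b' f f' =
   mon a a' e b.+1 b' f f'.+1 + mon a a' e b b'.+1 f.+1 f'.
  by rewrite /mon !exprS; ring.
by move=> H H'; apply: cl_addr H' H.
Qed.

Lemma cl_gen p k : (k <= n)%N ->
  (exists a r, [/\ a != 0, (msize r <= k)%N & M (a *: p + r)]) -> M p.
Proof.
move=> kn [a [r' [a0 rk H]]]; apply: (clZ_inv HM a0).
by apply: cl_addr H; apply: low; apply: leq_trans kn.
Qed.

(* Multiplication by wyv leads from exponent a to a + 1; all the other terms of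
   the product have already been dealt with. *)
Lemma mon_zpam a : (a.+1 + 2 * a.+1 = n)%N -> M (mon a.+1 0 0 0 (2 * a.+1) 0 0).
Proof.
case: a => [|a] sn.
  have -> : mon 1 0 0 0 2 0 0 = zp * am ^+ 2 by rewrite /mon; ring.
  by apply: cl_gen (cl_zpam HM); rewrite -sn.
have E : (2 * a.+2 = (2 * a.+1).+2)%N by lia.
rewrite E in sn *; have E1 : (2 * a.+1 = (2 * a).+2)%N by lia.
have q_low : (msize (mon a.+1 0 0 0 (2 * a.+1) 0 0) <= n)%N by apply: mon_low; lia.
have := cl_wyv q_low.
have -> : (zm * (ap ^+ 2 - bp ^+ 2) + zp * (am ^+ 2 - bm ^+ 2)
     + 2%:R * J * ze * (am * bp - ap * bm)) * mon a.+1 0 0 0 (2 * a.+1) 0 0 =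
  mon a.+2 0 0 0 (2 * a.+1).+2 0 0 +
  (mon a.+1 1 0 2 (2 * a.+1) 0 0 - mon a.+1 1 0 0 (2 * a.+1) 2 0
   - mon a.+2 0 0 0 (2 * a.+1) 0 2
   + 2%:R * (J * (mon a.+1 0 1 0 (2 * a.+1).+1 1 0 - mon a.+1 0 1 1 (2 * a.+1) 0 1))).
  by rewrite /mon !exprS; ring.
apply: cl_addr; apply: (clD HM).
  apply: clB; first apply: clB.
  - by apply: mon_zpzm; lia.
  - by apply: mon_zpzm; lia.
  - by rewrite E1; apply: mon_zpambm; lia.
by apply: cln; apply: clJ; apply: clB; apply: mon_zpze; lia.
Qed.

Lemma mon_zpbm a : (a.+1 + 2 * a.+1 = n)%N -> M (mon a.+1 0 0 0 0 0 (2 * a.+1)).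
Proof.
case: a => [|a] sn.
  have -> : mon 1 0 0 0 0 0 2 = zp * bm ^+ 2 by rewrite /mon; ring.
  by apply: cl_gen (cl_zpbm HM); rewrite -sn.
have E : (2 * a.+2 = (2 * a.+1).+2)%N by lia.
rewrite E in sn *; have E1 : (2 * a.+1 = (2 * a).+2)%N by lia.
have q_low : (msize (mon a.+1 0 0 0 0 0 (2 * a.+1)) <= n)%N by apply: mon_low; lia.
have := cl_wyv q_low.
have -> : (zm * (ap ^+ 2 - bp ^+ 2) + zp * (am ^+ 2 - bm ^+ 2)
     + 2%:R * J * ze * (am * bp - ap * bm)) * mon a.+1 0 0 0 0 0 (2 * a.+1) =
  - mon a.+2 0 0 0 0 0 (2 * a.+1).+2 +
  (mon a.+1 1 0 2 0 0 (2 * a.+1) - mon a.+1 1 0 0 0 2 (2 * a.+1)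
   + mon a.+2 0 0 0 2 0 (2 * a.+1)
   + 2%:R * (J * (mon a.+1 0 1 0 1 1 (2 * a.+1) - mon a.+1 0 1 1 0 0 (2 * a.+1).+1))).
  by rewrite /mon !exprS; ring.
move=> H; rewrite -[mon _ _ _ _ _ _ _]opprK; apply: clN; apply: cl_addr H.
apply: (clD HM).
  apply: (clD HM); first apply: clB.
  - by apply: mon_zpzm; lia.
  - by apply: mon_zpzm; lia.
  - by rewrite E1; apply: mon_zpambm; lia.
by apply: cln; apply: clJ; apply: clB; apply: mon_zpze; lia.
Qed.

(** In weight zero and without [zm] and [ze], a factor [am] or [bm] must occur. Both together are
    covered by [mon_zpambm]. Otherwise a factor [ap] or [bp] pairs either directly or after
    exchanging [am * bp] with [ap * bm]. Pure powers of [am] or [bm] remain, with exponent fixed by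
    the weight. *)
Lemma mon_zp a a' e b b' f f' : (a.+1 + a' + e + b + b' + f + f' = n)%N ->
  M (mon a.+1 a' e b b' f f').
Proof.
move=> sn; have [w|] := boolP (2 * a.+1 + b + f != 2 * a' + b' + f')%N.
  exact: mon_weight.
rewrite negbK => /eqP w.
case: a' => [|a'] in sn w *; last exact: mon_zpzm.
case: e => [|e] in sn w *; last exact: mon_zpze.
case: b' => [|b'] in sn w *.
  case: f => [|f] in sn w *; last by (case: f' => [|f'] in sn w *; [lia | apply: mon_bpbm; lia]).
  case: b => [|b] in sn w *.
    have -> : f' = (2 * a.+1)%N by lia.
    by apply: mon_zpbm; lia.
  case: f' => [|[|f']] in sn w *; [lia | lia |].
  by apply: mon_apbm; [lia | apply: mon_bpbm; lia].
case: f' => [|f'] in sn w *; last by apply: mon_zpambm; lia.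
case: b => [|b] in sn w *; last by apply: mon_apam; lia.
case: f => [|f] in sn w *.
  have -> : b'.+1 = (2 * a.+1)%N by lia.
  by apply: mon_zpam; lia.
case: b' => [|b'] in sn w *; first lia.
by apply: mon_ambp; [lia | apply: mon_apam; lia].
Qed.

Lemma mon_ze e : (e = n)%N -> M (mon 0 0 e 0 0 0 0).
Proof.
case: e => [|[|e]] en; last by apply: mon_zeze; lia.
  have -> : mon 0 0 0 0 0 0 0 = 1 by rewrite /mon; ring.
  (* The constant is fixed by the reflection, where [eta] is -1, so the relation gives 2. *)
  by apply: (@cln_inv 1); have := cl_refl HM 1; rewrite comp_mpoly1 mulr1.
have -> : mon 0 0 1 0 0 0 0 = ze by rewrite /mon; ring.
by apply: cl_gen (cl_ze HM); rewrite -en.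
Qed.

Lemma cl_ze_low : (1 < n)%N -> M ze.
Proof. by move=> n1; apply: low; rewrite /ze (leq_trans (msize_x 2)). Qed.

(** For exponent 1 the scalar relation gives [ap * bm] = - [am * bp]. With one factor [ze] the
    reflection gives the opposite sign, so both vanish. Without [ze] it gives the same sign, and the
    antisymmetric combination must come from [cl_commutator]. *)
Lemma mon_ap_bm e b : (e + b.+1 + b.+1 = n)%N -> M (mon 0 0 e b.+1 0 0 b.+1).
Proof.
move=> sn; case: b => [|b] in sn *; last by apply: mon_apbm; [lia | apply: mon_apam; lia].
case: e => [|[|e]] in sn *; last by apply: mon_zeze; lia.
  have Mz : M ze by apply: cl_ze_low; lia.
  have := clD HM (cl_apbm (q := 1) _) (cln 2 (clJ (cl_commutator c0 HM Mz))).
  move/(_ _); have q1_low : (msize (1 : P) <= n)%N by rewrite msize1; lia.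
  move/(_ q1_low) => H; apply: (@cln_inv 1); move: H; congr M.
  by rewrite /mon /ap /bm /am /bp; ring: JJ.
have q_low : (msize (mon 0 0 1 0 0 0 0) <= n)%N by apply: mon_low; lia.
have := cl_refl HM (mon 0 0 1 1 0 0 1); rewrite mon_comp_refl => H.
have := clD HM (cl_apbm q_low) H => H'.
by apply: (@cln_inv 1); move: H'; congr M; rewrite /mon; ring.
Qed.

Lemma mon_M a a' e b b' f f' : (a + a' + e + b + b' + f + f' = n)%N ->
  M (mon a a' e b b' f f').
Proof.
case: a => [|a] sn; last exact: mon_zp.
case: a' => [|a'] in sn *; first last.
  by apply: mon_refl; apply: mon_zp; lia.
have [w|] := boolP (2 * 0 + b + f != 2 * 0 + b' + f')%N; first exact: mon_weight.
rewrite negbK => /eqP w.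
case: b => [|b] in sn w *.
  case: f => [|f] in sn w *.
    have [-> ->] : b' = 0 /\ f' = 0 by lia.
    by apply: mon_ze; lia.
  case: f' => [|f'] in sn w *; last by apply: mon_bpbm; lia.
  have -> : b' = f.+1 by lia.
  by apply: mon_refl; apply: mon_ap_bm; lia.
case: b' => [|b'] in sn w *; last by apply: mon_apam; lia.
case: f' => [|f'] in sn w *; first lia.
case: f => [|f] in sn w *; last by apply: mon_bpbm; lia.
have -> : f' = b by lia.
by apply: mon_ap_bm; lia.
Qed.

End Descent.

(** * Spanning by the monomials in rotation eigenvectors *)

Section Span.
Variables (K : numFieldType) (c iK : K).
Local Notation P := {mpoly K[7]}.
Implicit Types (p q : P).
Local Notation x := (@mvar K).
Hypotheses (c0 : c != 0) (iK2 : iK * iK = -1).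
Variable M : P -> Prop.
Hypothesis HM : closed_submodule c iK M.

Definition eig_sub : 7.-tuple P :=
  [tuple zp iK; zm iK; ze K; ap iK; am iK; bp iK; bm iK].

Definition eig_inv : 7.-tuple P :=
  [tuple 2^-1 *: (x 0 + x 1); (- iK / 2) *: (x 0 - x 1); x 2;
         2^-1 *: (x 3 + x 4); (- iK / 2) *: (x 3 - x 4);
         2^-1 *: (x 5 + x 6); (- iK / 2) *: (x 5 - x 6)].

(** Expanding the outer composition writes [p] as a combination of the monomials [mon], with no
    increase in degree. *)
Lemma eig_invK p : (p \mPo eig_inv) \mPo eig_sub = p.
Proof.
have X k : (k < 7)%N -> x k \mPo eig_sub = eig_sub`_k.
  by move=> k7; rewrite mvarE comp_mpolyXU inordK.
elim/mpoly_XUind: p => [a|i|p q IHp IHq|p q IHp IHq].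
- by rewrite !comp_mpolyC.
- have e1 (u v : P) : 2^-1 *: ((u + imagC iK * v) + (u - imagC iK * v)) = u.
    have -> : (u + imagC iK * v) + (u - imagC iK * v) = 2%:R *: u.
      by rewrite -mul_mpolyC mpolyC_nat; ring.
    by rewrite scalerA mulVf ?pnatr_eq0 // scale1r.
  have e2 (u v : P) : (- iK / 2) *: ((u + imagC iK * v) - (u - imagC iK * v)) = v.
    have -> : (u + imagC iK * v) - (u - imagC iK * v) = (2%:R * iK) *: v.
      by rewrite -mul_mpolyC mpolyCM mpolyC_nat -imagCE; ring.
    by rewrite scalerA -mulrA mulKf ?pnatr_eq0 // mulNr iK2 opprK scale1r.
  rewrite comp_mpolyXU.
  by case: i => [[|[|[|[|[|[|[|//]]]]]]] li];
    rewrite /= ?comp_mpolyZ ?comp_mpolyD ?comp_mpolyN !X //= ?(e1, e2);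
    rewrite /ze mvarE;
    congr ('X_ _); apply/val_inj; rewrite /= inordK.
- by rewrite !rmorphD /= IHp IHq.
- by rewrite !rmorphM /= IHp IHq.
Qed.

Lemma prod_eig_sub (m : 'X_{1..7}) : exists a a' e b b' f f',
  (a + a' + e + b + b' + f + f' = mdeg m)%N /\
  \prod_(i < 7) tnth eig_sub i ^+ m i = mon iK a a' e b b' f f'.
Proof.
rewrite mdegE !big_ord_recl !big_ord0 !(tnth_nth 0) /=.
do 7!eexists; split; last by rewrite /mon mulr1 !mulrA; reflexivity.
by rewrite addn0 !addnA.
Qed.

Lemma msize_eig_inv i : (msize (tnth eig_inv i) <= 2)%N.
Proof.
rewrite (tnth_nth 0).
by case: i => [[|[|[|[|[|[|[|//]]]]]]] li] /=;
  rewrite ?msize_x //; apply: msize_scale;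
  apply: msize_add; rewrite ?msizeN msize_x.
Qed.

Lemma closed_submodule_full p : M p.
Proof.
have : (msize p <= msize p)%N by [].
elim: (msize p) {-2}p => {p} [|n IHn] p pn.
  by move: pn; rewrite leqn0 msize_poly_eq0 => /eqP->; apply: cl0 HM.
rewrite -[p]eig_invK; set q := p \mPo eig_inv.
have qn : (msize q <= n.+1)%N by apply: msize_comp => // i; apply: msize_eig_inv.
rewrite comp_mpolyE big_seq; elim/big_ind: _ => [|u v|m mq].
- exact: cl0 HM.
- exact: (clD HM).
apply: (clZ HM).
have [a [a' [e [b [b' [f [f' [s ->]]]]]]]] := prod_eig_sub m.
have := leq_trans (msize_mdeg_lt mq) qn; rewrite ltnS leq_eqVlt => /orP[/eqP mn|mn].
  by apply: (mon_M c0 iK2 HM IHn); rewrite s.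
by apply/IHn/(leq_trans (msize_mon _ _ _ _ _ _ _ _)); rewrite s.
Qed.

End Span.

(** * Laplacians and vector fields in coordinates *)

Section Explicit.
Variables (K : numFieldType) (c : K).
Local Notation P := {mpoly K[7]}.
Implicit Types (p q : P).
Local Notation x := (@mvar K).
Local Notation D := (@sderk K c).

Lemma lap_W0 (s : 'I_7 -> K) p : s (inord 0) = 1 -> s (inord 1) = 1 ->
  s (inord 2) = -1 -> lap c W0 s p = lap0 c p.
Proof.
move=> s0 s1 s2; rewrite /lap big_mkcond big7 !inE !inordK //= s0 s1 s2.
by rewrite /lap0 !sderkE scaleN1r !scale1r !addr0 addrA.
Qed.

Lemma lap_W1 (s : 'I_7 -> K) p : s (inord 3) = 1 -> s (inord 4) = 1 ->
  s (inord 5) = -1 -> s (inord 6) = -1 -> lap c W1 s p = lap1 c p.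
Proof.
move=> s3 s4 s5 s6; rewrite /lap big_mkcond big7 !inE !inordK //= s3 s4 s5 s6.
by rewrite /lap1 !sderkE !scaleN1r !scale1r !add0r !addrA.
Qed.

(** Empty rows stand for zero rows, through the default of [nth]. *)
Definition table (t : seq (seq K)) (j k : 'I_7) : K := (nth [::] t j)`_k.

Lemma vfield_table M t p : (forall j k, M j k = table t j k) ->
  vfield c M p = vfield c (table t) p.
Proof.
move=> Mt; apply: eq_bigr => j _; congr (_ * _).
by apply: eq_bigr => k _; rewrite Mt.
Qed.

Lemma linf_table t (j : nat) : (j < 7)%N -> linf (table t) (inord j) =
  let r k := (nth [::] t j)`_k in
  r 0 *: x 0 + (r 1 *: x 1 + (r 2 *: x 2 + (r 3 *: x 3 + (r 4 *: x 4 +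
  (r 5 *: x 5 + r 6 *: x 6))))).
Proof. by move=> j7; rewrite /linf /table big7 !inordK // !mvarE. Qed.

Ltac table :=
  rewrite /vfield big7 !linf_table //= -!sderkE !(scale0r, scale1r, scaleN1r)
    -?mul_mpolyC ?mpolyCN ?mpolyC_nat; ring.

Lemma vfield_rot p : vfield c (table
    [:: [:: 0; - 2%:R; 0; 0; 0; 0; 0]; [:: 2%:R; 0; 0; 0; 0; 0; 0]; [::];
        [:: 0; 0; 0; 0; -1; 0; 0]; [:: 0; 0; 0; 1; 0; 0; 0];
        [:: 0; 0; 0; 0; 0; 0; -1]; [:: 0; 0; 0; 0; 0; 1; 0]]) p =
  2%:R * (x 0 * D 1 p - x 1 * D 0 p)
     + (x 3 * D 4 p - x 4 * D 3 p) + (x 5 * D 6 p - x 6 * D 5 p).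
Proof. by table. Qed.

Lemma vfield_scal p : vfield c (table
    [:: [::]; [::]; [::];
        [:: 0; 0; 0; 0; 0; 1; 0]; [:: 0; 0; 0; 0; 0; 0; 1];
        [:: 0; 0; 0; 1; 0; 0; 0]; [:: 0; 0; 0; 0; 1; 0; 0]]) p =
  x 5 * D 3 p + x 3 * D 5 p + x 6 * D 4 p + x 4 * D 6 p.
Proof. by table. Qed.

Lemma vfield_diag p : vfield c (table
    [:: [::]; [:: 0; 0; - 2%:R; 0; 0; 0; 0]; [:: 0; - 2%:R; 0; 0; 0; 0; 0];
        [:: 0; 0; 0; 0; 0; 1; 0]; [:: 0; 0; 0; 0; 0; 0; -1];
        [:: 0; 0; 0; 1; 0; 0; 0]; [:: 0; 0; 0; 0; -1; 0; 0]]) p =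
  - 2%:R * (x 2 * D 1 p + x 1 * D 2 p)
     + (x 5 * D 3 p + x 3 * D 5 p) - (x 6 * D 4 p + x 4 * D 6 p).
Proof. by table. Qed.

Lemma vfield_symm p : vfield c (table
    [:: [:: 0; 0; 2%:R; 0; 0; 0; 0]; [::]; [:: 2%:R; 0; 0; 0; 0; 0; 0];
        [:: 0; 0; 0; 0; 0; 0; 1]; [:: 0; 0; 0; 0; 0; 1; 0];
        [:: 0; 0; 0; 0; 1; 0; 0]; [:: 0; 0; 0; 1; 0; 0; 0]]) p =
  2%:R * (x 2 * D 0 p + x 0 * D 2 p)
     + (x 6 * D 3 p + x 3 * D 6 p) + (x 5 * D 4 p + x 4 * D 5 p).
Proof. by table. Qed.
End Explicit.

Import numFieldNormedType.Exports.
Local Open Scope classical_set_scope.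
Local Open Scope complex_scope.
Local Open Scope ring_scope.

(** * Derivatives of polynomials times the Gaussian *)

Section Calculus.
Variable R : realType.
Local Notation C := R[i].

(** Since [cderiv0] is total, its value says nothing about differentiability; the sum and product
    rules need this stronger statement. *)
Definition has_cderiv0 (f : R -> C) (z : C) : Prop :=
  is_derive (0 : R) (1 : R) (fun t => complex.Re (f t)) (complex.Re z) /\
  is_derive (0 : R) (1 : R) (fun t => complex.Im (f t)) (complex.Im z).

Lemma has_cderiv0E f z : has_cderiv0 f z -> cderiv0 f = z.
Proof.
case=> fr fi; rewrite /cderiv0 !derive1E.
by rewrite (@derive_val _ _ _ _ _ _ _ fr) (@derive_val _ _ _ _ _ _ _ fi); case: z {fr fi}.
Qed.

Lemma near_has_cderiv0 (f g : R -> C) z : (\forall t \near (0 : R), f t = g t) ->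
  has_cderiv0 f z -> has_cderiv0 g z.
Proof.
move=> fg [fr fi]; split.
  apply: near_eq_is_derive fr.
  by near=> t; rewrite (near fg t).
apply: near_eq_is_derive fi.
by near=> t; rewrite (near fg t).
Unshelve. all: by end_near. Qed.

Lemma has_cderiv0_cst (z : C) : has_cderiv0 (fun=> z) 0.
Proof. by split; apply: is_derive_cst. Qed.

Lemma has_cderiv0D f g z w : has_cderiv0 f z -> has_cderiv0 g w ->
  has_cderiv0 (fun t => f t + g t) (z + w).
Proof.
case=> fr fi [gr gi]; split; rewrite !raddfD /=.
  have -> : (fun t => complex.Re (f t + g t)) =
     (fun t => complex.Re (f t)) + (fun t => complex.Re (g t)).
    by apply/funext => t; rewrite raddfD.
  exact: is_deriveD.
have -> : (fun t => complex.Im (f t + g t)) =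
     (fun t => complex.Im (f t)) + (fun t => complex.Im (g t)).
  by apply/funext => t; rewrite raddfD.
exact: is_deriveD.
Qed.

Lemma ReM (z w : C) : complex.Re (z * w) =
  complex.Re z * complex.Re w - complex.Im z * complex.Im w.
Proof. by case: z w => [a b] [c d]. Qed.

Lemma ImM (z w : C) : complex.Im (z * w) =
  complex.Re z * complex.Im w + complex.Im z * complex.Re w.
Proof. by case: z w => [a b] [c d]. Qed.

Lemma has_cderiv0M f g z w : has_cderiv0 f z -> has_cderiv0 g w ->
  has_cderiv0 (fun t => f t * g t) (z * g 0 + f 0 * w).
Proof.
case=> fr fi [gr gi]; split; rewrite !raddfD /= ?(ReM, ImM).
  have -> : (fun t => complex.Re (f t * g t)) =
     (fun t => complex.Re (f t)) * (fun t => complex.Re (g t)) -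
     (fun t => complex.Im (f t)) * (fun t => complex.Im (g t)).
    by apply/funext => t; rewrite ReM.
  apply: is_derive_eq (is_deriveB (is_deriveM fr gr) (is_deriveM fi gi)) _.
  by rewrite /GRing.scale /=; ring.
have -> : (fun t => complex.Im (f t * g t)) =
     (fun t => complex.Re (f t)) * (fun t => complex.Im (g t)) +
     (fun t => complex.Im (f t)) * (fun t => complex.Re (g t)).
  by apply/funext => t; rewrite ImM.
apply: is_derive_eq (is_deriveD (is_deriveM fr gi) (is_deriveM fi gr)) _.
by rewrite /GRing.scale /=; ring.
Qed.

Lemma has_cderiv0_real (f : R -> R) d : is_derive (0 : R) (1 : R) f d ->
  has_cderiv0 (fun t => (f t)%:C) d%:C.
Proof. by move=> fd; split => //=; apply: is_derive_cst. Qed.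

Lemma has_cderiv0_eq f z w : has_cderiv0 f z -> z = w -> has_cderiv0 f w.
Proof. by move=> fz <-. Qed.

(** One chain rule along curves serves coordinate lines, their images under O(2), and the curves
    that define [gl_deriv]. *)
Definition has_velocity (c : R -> s2 R) (d : 'I_7 -> R) : Prop :=
  forall j, is_derive (0 : R) (1 : R) (fun t => c t 0 j) (d j).

Lemma has_cderiv0_pfun c d p : has_velocity c d ->
  has_cderiv0 (fun t => pfun p (c t)) (\sum_j (d j)%:C * pfun p^`M(j) (c 0)).
Proof.
move=> cd; elim/mpoly_XUind: p => [z|i|p q IHp IHq|p q IHp IHq].
- rewrite /pfun; under eq_fun do rewrite mevalC.
  rewrite big1 => [|j _]; first exact: has_cderiv0_cst.
  by rewrite mderivC meval0 mulr0.
- rewrite /pfun; under eq_fun do rewrite mevalXU.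
  rewrite (bigD1 i) //= big1 ?addr0 => [|j /negPf ji]; last first.
    by rewrite mderivX mnmE eq_sym ji scale0r meval0 mulr0.
  rewrite mderivX mnmE eqxx scale1r mevalX big1 ?mulr1.
    exact: has_cderiv0_real.
  by move=> j _; rewrite !mnmE subnn expr0.
- rewrite /pfun; under eq_fun do rewrite mevalD.
  apply: has_cderiv0_eq (has_cderiv0D IHp IHq) _.
  rewrite -big_split /=; apply: eq_bigr => j _.
  by rewrite mderivD mevalD mulrDr.
- rewrite /pfun; under eq_fun do rewrite mevalM.
  apply: has_cderiv0_eq (has_cderiv0M IHp IHq) _.
  rewrite mulr_suml mulr_sumr -big_split /=; apply: eq_bigr => j _.
  rewrite mderivM mevalD !mevalM mulrDr; congr (_ + _); first by rewrite mulrA.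
  by rewrite mulrCA.
Qed.

Definition sch (p : {mpoly C[7]}) : cfun R := pfun p * @gauss R.

Definition cpi : C := (2 * pi)%:C.

Lemma pfun_sder j p X :
  pfun (sder cpi j p) X = pfun p^`M(j) X - cpi * ((X 0 j)%:C * pfun p X).
Proof. by rewrite /pfun mevalB mevalZ mevalM mevalXU. Qed.

Lemma has_cderiv0_gauss c d : has_velocity c d ->
  has_cderiv0 (fun t => gauss (c t))
    (- (cpi * (\sum_j (d j * c 0 0 j)%:C) * gauss (c 0))).
Proof.
move=> cd.

have sq : is_derive (0 : R) (1 : R) (fun t => - (pi * \sum_j c t 0 j ^+ 2))
   (- (pi * \sum_j (2 * d j * c 0 0 j))).
  have -> : (fun t => - (pi * \sum_j c t 0 j ^+ 2)) =
    - (pi *: \sum_(j < 7) (fun t => c t 0 j) ^+ 2).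
    by apply/funext => t; rewrite /= fct_sumE.
  apply: is_deriveN; apply: is_deriveZ; apply: is_derive_sum => j.
  apply: is_derive_eq; first exact: is_deriveX.
  by rewrite expr1 /GRing.scale /=; ring.
have := is_derive1_comp (is_derive_expR _) sq.
move=> /has_cderiv0_real; move/has_cderiv0_eq; apply.
rewrite /gauss /= -raddf_sum -!rmorphM /= -rmorphN /=; congr (_%:C).
rewrite mulrC -mulNr; congr (_ * _); congr (- _).
rewrite -mulrA !mulr_sumr; apply: eq_bigr => j _; ring.
Qed.

Lemma has_cderiv0_sch c d p : has_velocity c d ->
  has_cderiv0 (fun t => sch p (c t)) (\sum_j (d j)%:C * sch (sder cpi j p) (c 0)).
Proof.
move=> cd.
have := has_cderiv0M (has_cderiv0_pfun p cd) (has_cderiv0_gauss cd).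
move/has_cderiv0_eq; apply.
rewrite -mulNr mulrA -mulrDl -[RHS]/(\sum_j (d j)%:C * (pfun (sder cpi j p) (c 0) * gauss (c 0))).
under [RHS]eq_bigr do rewrite mulrA; rewrite -mulr_suml; congr (_ * _).
rewrite mulrN mulrCA !mulr_sumr -sumrB; apply: eq_bigr => j _.
rewrite pfun_sder rmorphM /= mulrBr; congr (_ - _).
by rewrite [RHS]mulrCA; congr (_ * _); rewrite mulrCA; congr (_ * _); rewrite mulrC.
Qed.

Lemma partial_sch j p : partial j (sch p) = sch (sder cpi j p).
Proof.
apply/funext => X; rewrite /partial.
have cd : has_velocity (fun t => X + t *: delta_mx 0 j) (fun k => (k == j)%:R).
  move=> k; have -> : (fun t => (X + t *: delta_mx 0 j) 0 k) =
    cst (X 0 k) + (k == j)%:R *: (id : R -> R).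
    by apply/funext => t; rewrite !mxE eqxx /= mulrC.
  apply: is_derive_eq (is_deriveD (is_derive_cst _ _ _) (is_deriveZ _ (is_derive_id _ _))) _.
  by rewrite add0r; exact: mulr1.
rewrite (has_cderiv0E (has_cderiv0_sch p cd)) (bigD1 j) //= eqxx mul1r.
rewrite big1 ?addr0 ?scale0r ?addr0 // => k /negPf->; exact: mul0r.
Qed.

Fact sch_is_linear : linear sch.
Proof.
move=> a p q; apply/funext => X.
rewrite -[LHS]/(pfun (a *: p + q) X * gauss X).
rewrite -[RHS]/(a * (pfun p X * gauss X) + pfun q X * gauss X).
by rewrite /pfun mevalD mevalZ mulrDl mulrA.
Qed.
HB.instance Definition _ :=
  GRing.isLinear.Build C {mpoly C[7]} (cfun R) *:%R sch sch_is_linear.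

End Calculus.

(** * The infinitesimal action of 2 by 2 matrices *)

Section Matrices.
Variable R : realType.

(** The velocity at t = 0 of the inverse of 1 + tL acting on a point: y, v, w move by yL - Ly, -Lv,
    wL. *)
Definition vf_mx (L : 'M[R]_2) (j k : 'I_7) : R :=
  let: (a, b, c, d) := (L 0 0, L 0 1, L 1 0, L 1 1) in
  let: (p, m) := (b + c, b - c) in
  (nth [::]
    [:: [:: 0; - m; p; 0; 0; 0; 0];
        [:: m; 0; d - a; 0; 0; 0; 0];
        [:: p; d - a; 0; 0; 0; 0; 0];
        [:: 0; 0; 0; 0; - m / 2; a; p / 2];
        [:: 0; 0; 0; m / 2; 0; p / 2; d];
        [:: 0; 0; 0; a; p / 2; 0; - m / 2];
        [:: 0; 0; 0; p / 2; d; m / 2; 0]] j)`_k.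

Lemma I2P (i : 'I_2) : (i = 0) \/ (i = 1).
Proof. by case: i => [[|[|//]]] ?; [left | right]; apply/val_inj. Qed.

Lemma mx2E (A : 'M[R]_2) : A = mx2 (A 0 0) (A 0 1) (A 1 0) (A 1 1).
Proof.
by apply/matrixP => i j; rewrite mxE; case: (I2P i) => ->; case: (I2P j) => ->.
Qed.

Lemma mul_mx2 (a b c d a' b' c' d' : R) :
  mx2 a b c d *m mx2 a' b' c' d' =
  mx2 (a * a' + b * c') (a * b' + b * d') (c * a' + d * c') (c * b' + d * d').
Proof.
apply/matrixP => i j; rewrite !mxE !big_ord_recl big_ord0 !mxE /= addr0.
by case: i => [[|[|//]]] ?; case: j => [[|[|//]]] ? //=.
Qed.

Lemma det_mx2 (a b c d : R) : \det (mx2 a b c d) = a * d - b * c.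
Proof.
rewrite (expand_det_row _ 0) !big_ord_recl big_ord0 /cofactor !det_mx11 !mxE /=.
by rewrite /bump /= !expr0 expr1; ring.
Qed.

Lemma invmx_mx2 (a b c d : R) : a * d - b * c != 0 ->
  invmx (mx2 a b c d) = (a * d - b * c)^-1 *: mx2 d (- b) (- c) a.
Proof.
move=> D0.
have E : mx2 a b c d *m ((a * d - b * c)^-1 *: mx2 d (- b) (- c) a) = 1%:M.
  rewrite -scalemxAr mul_mx2; apply/matrixP => i j; rewrite !mxE.
  by case: i => [[|[|//]]] ?; case: j => [[|[|//]]] ? //=; rewrite ?mulr1n ?mulr0n; field.
have u : mx2 a b c d \in unitmx by rewrite unitmxE det_mx2 unitfE.
by rewrite -[RHS](mulKmx u) E mulmx1.
Qed.

Lemma mul_mx2_col (a b c d : R) (v : 'cV[R]_2) :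
  mx2 a b c d *m v =
  \col_i (if i == 0 then a * v 0 0 + b * v 1 0 else c * v 0 0 + d * v 1 0).
Proof.
have e1 : lift ord0 ord0 = 1 :> 'I_2 by apply/val_inj.
apply/colP => i; rewrite !mxE !big_ord_recl big_ord0 !mxE /= addr0 e1.
by case: (I2P i) => ->.
Qed.

Lemma mul_row_mx2 (a b c d : R) (w : 'rV[R]_2) :
  w *m mx2 a b c d =
  \row_j (if j == 0 then w 0 0 * a + w 0 1 * c else w 0 0 * b + w 0 1 * d).
Proof.
have e1 : lift ord0 ord0 = 1 :> 'I_2 by apply/val_inj.
apply/rowP => i; rewrite !mxE !big_ord_recl big_ord0 !mxE /= addr0 e1.
by case: (I2P i) => ->.
Qed.

Definition vf (L : 'M[R]_2) (X : s2 R) (j : 'I_7) : R := \sum_k vf_mx L j k * X 0 k.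

(** By Cramer's rule the coordinates along the curve are quotients of polynomials in t by D = det(1
    + tL), so they can be differentiated formally, with D(0) = 1 and D'(0) = tr L. *)
Lemma gl_curve_velocity (L : 'M[R]_2) (X : s2 R) :
  has_velocity (fun t => act (invmx (1%:M + t *: L)) X) (vf L X).
Proof.
pose a := L 0 0; pose b := L 0 1; pose c := L 1 0; pose d := L 1 1.
pose ha : {poly R} := 1 + a *: 'X; pose hb : {poly R} := b *: 'X.
pose hc : {poly R} := c *: 'X; pose hd : {poly R} := 1 + d *: 'X.
pose D : {poly R} := ha * hd - hb * hc.
have haE t : ha.[t] = 1 + a * t by rewrite /ha hornerD hornerC hornerZ hornerX.
have hbE t : hb.[t] = b * t by rewrite /hb hornerZ hornerX.
have hcE t : hc.[t] = c * t by rewrite /hc hornerZ hornerX.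
have hdE t : hd.[t] = 1 + d * t by rewrite /hd hornerD hornerC hornerZ hornerX.
have dha : ha^`() = a%:P by rewrite /ha derivD derivC derivZ derivX add0r alg_polyC.
have dhb : hb^`() = b%:P by rewrite /hb derivZ derivX alg_polyC.
have dhc : hc^`() = c%:P by rewrite /hc derivZ derivX alg_polyC.
have dhd : hd^`() = d%:P by rewrite /hd derivD derivC derivZ derivX add0r alg_polyC.
clearbody ha hb hc hd.
have hE t : 1%:M + t *: L = mx2 ha.[t] hb.[t] hc.[t] hd.[t].
  rewrite [LHS]mx2E !mxE /= ?mulr1n ?mulr0n ?add0r haE hbE hcE hdE.
  by congr mx2; rewrite mulrC.
have DE t : D.[t] = ha.[t] * hd.[t] - hb.[t] * hc.[t].
  by rewrite hornerD hornerN !hornerM.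
have D0 : D.[0] = 1 by rewrite DE haE hbE hcE hdE; ring.
pose dE := (derivX, derivC, derivD, derivN, derivM, derivZ, dha, dhb, dhc, dhd).
pose vE := (hornerX, hornerD, hornerN, hornerM, hornerZ, hornerC, DE, haE, hbE, hcE, hdE).
have D1 : D^`().[0] = a + d.
  by rewrite /D !dE !vE; ring.
clearbody D.
have Dnz : \forall t \near (0 : R), D.[t] != 0.
  have /cvgr_neq0 : horner D t @[t --> (0 : R)] --> D.[0].
    exact: continuous_horner.
  by apply; rewrite D0 oner_neq0.
pose x k : R := X 0 (inord k).
pose y00 := x 0%N / 2; pose y01 := (x 1%N + x 2%N) / 2; pose y10 := (x 1%N - x 2%N) / 2.
pose v0 := (x 3%N - x 5%N) / 2; pose v1 := (x 4%N - x 6%N) / 2.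
pose w0 := (x 3%N + x 5%N) / 2; pose w1 := (x 4%N + x 6%N) / 2.
pose V0 : {poly R} := v0 *: hd - v1 *: hb; pose V1 : {poly R} := v1 *: ha - v0 *: hc.
pose W0 : {poly R} := w0 *: ha + w1 *: hc; pose W1 : {poly R} := w0 *: hb + w1 *: hd.
pose P00 : {poly R} := y00 *: hd - y10 *: hb; pose P01 : {poly R} := y01 *: hd + y00 *: hb.
pose P10 : {poly R} := y10 *: ha - y00 *: hc; pose P11 : {poly R} := - y00 *: ha - y01 *: hc.
pose Y00 : {poly R} := P00 * ha + P01 * hc; pose Y01 : {poly R} := P00 * hb + P01 * hd.
pose Y10 : {poly R} := P10 * ha + P11 * hc.
(* The entries of y and v carry the denominator D of the inverse matrix; those of w carry none and
   are multiplied by D. *)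
pose N : seq {poly R} := [:: 2 *: Y00; Y01 + Y10; Y01 - Y10; V0 + W0 * D; V1 + W1 * D;
   W0 * D - V0; W1 * D - V1].
have cE t (j : 'I_7) : D.[t] != 0 ->
   act (invmx (1%:M + t *: L)) X 0 j = (N`_j).[t] / D.[t].
  rewrite DE hE => Dt; rewrite /act /point /= invmxK invmx_mx2 //.
  rewrite -!scalemxAl !mul_mx2 !mul_mx2_col !mul_row_mx2 !mxE /=.
  move: Dt.
  case: j => [[|[|[|[|[|[|[|//]]]]]]] lj] /=;
  rewrite /Y00 /Y01 /Y10 /P00 /P01 /P10 /P11 /V0 /V1 /W0 /W1 /y00 /y01 /y10 /v0 /v1 /w0 /w1 /x;
  rewrite ?(hornerD, hornerN, hornerM, hornerZ, DE) ?(haE, hbE, hcE, hdE);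
  by move=> Dt; field; exact: Dt.
move=> j.
have dN : (N`_j)^`().[0] - (N`_j).[0] * (a + d) = vf L X j.
  rewrite /vf big7 /vf_mx !inordK //.
  case: j => [[|[|[|[|[|[|[|//]]]]]]] lj] /=;
  rewrite /Y00 /Y01 /Y10 /P00 /P01 /P10 /P11 /V0 /V1 /W0 /W1 /y00 /y01 /y10 /v0 /v1 /w0 /w1 /x;
  rewrite ?dE ?vE ?D1 /= -/a -/b -/c -/d;
  by field.
apply: (@near_eq_is_derive _ _ _ (fun t => (N`_j).[t] / D.[t])).
  by near=> t; rewrite cE //; near: t.
have D0' : D.[0] != 0 by rewrite D0 oner_neq0.
have := is_deriveM (is_derive_poly (N`_j) 0) (is_deriveV D0' (is_derive_poly D 0)).
move/is_derive_eq; apply; rewrite D0 D1 -dN /GRing.scale /= expr1n invr1.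
ring.
Unshelve. all: end_near.
Qed.

End Matrices.

(** * The action of gl_2 on polynomials times the Gaussian *)

Section Deriv.
Variable R : realType.
Local Notation C := R[i].
Lemma gl_deriv_has (L : 'M[R]_2) (p : {mpoly C[7]}) (X : s2 R) :
  has_cderiv0 (fun t => gl_translate (1%:M + t *: L) (sch p) X)
    (\sum_j (vf L X j)%:C * sch (sder (cpi R) j p) X).
Proof.
have := has_cderiv0_sch p (gl_curve_velocity L X).
rewrite scale0r addr0 invmx1.
have -> // : act 1%:M X = X.
rewrite -[RHS]pointK /act; case: (Defs.point X) => -[y v] w.
by rewrite invmx1 !mul1mx !mulmx1.
Qed.

Definition gl_mx (L : 'M[R]_2) (j k : 'I_7) : C := (vf_mx L j k)%:C.

Lemma gl_deriv_sch (L : 'M[R]_2) (p : {mpoly C[7]}) :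
  gl_deriv L (sch p) = sch (vfield (cpi R) (gl_mx L) p).
Proof.
apply/funext => X; rewrite /gl_deriv (has_cderiv0E (gl_deriv_has L p X)).
rewrite -[RHS]/(pfun (vfield (cpi R) (gl_mx L) p) X * gauss X) /pfun /vfield raddf_sum mulr_suml /=.
apply: eq_bigr => j _; rewrite -[sch _ _]/(pfun (sder (cpi R) j p) X * gauss X) mulrA /pfun mevalM.
congr (_ * _ * _); rewrite /vf /linf raddf_sum /= rmorph_sum /gl_mx.
by apply: eq_bigr => k _; rewrite rmorphM /= mevalZ mevalXU.
Qed.

(** Invariance holds for invertible matrices only, so [u] is constant along the curve just for small
    t, which suffices for the derivative. *)
Lemma gl_deriv_inv (u : {mpoly C[7]}) (L : 'M[R]_2) (p : {mpoly C[7]}) : GL2_invariant u ->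
  gl_deriv L (pfun u * sch p) = pfun u * gl_deriv L (sch p).
Proof.
move=> uinv; apply/funext => X; rewrite -[RHS]/(pfun u X * gl_deriv L (sch p) X).
rewrite /gl_deriv (has_cderiv0E (gl_deriv_has L p X)).
apply: has_cderiv0E.
have H := has_cderiv0M (has_cderiv0_cst (pfun u X)) (gl_deriv_has L p X).
rewrite mul0r add0r in H; apply: near_has_cderiv0 H.
have Du : \forall t \near (0 : R), (1%:M + t *: L) \in unitmx.
  (* The determinant of 1 + tL is a polynomial in t with value 1 at 0, hence nonzero nearby. *)
  pose P : {poly R} := (1 + L 0 0 *: 'X) * (1 + L 1 1 *: 'X) - (L 0 1 * L 1 0) *: 'X^2.
  have PE t : P.[t] = \det (1%:M + t *: L).
    rewrite [X in \det X]mx2E det_mx2 !mxE /= ?mulr1n ?mulr0n ?add0r.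
    by rewrite /P !hornerE /=; ring.
  have P0 : P.[0] = 1 by rewrite PE scale0r addr0 det1.
  have /cvgr_neq0 : horner P t @[t --> (0 : R)] --> P.[0].
    exact: continuous_horner.
  rewrite P0 => /(_ (oner_neq0 _)).
  by apply: filterS => t; rewrite PE unitmxE unitfE.
near=> t.
rewrite -[RHS]/(pfun u (act (invmx (1%:M + t *: L)) X) * _).
by rewrite uinv // unitmx_inv; near: t.
Unshelve. all: end_near.
Qed.

Lemma gl_translate_inv (u : {mpoly C[7]}) (k : 'M[R]_2) (Phi : cfun R) :
  GL2_invariant u -> k \in unitmx ->
  gl_translate k (pfun u * Phi) = pfun u * gl_translate k Phi.
Proof.
move=> uinv ku; apply/funext => X.
rewrite /gl_translate -[LHS]/(pfun u (act (invmx k) X) * _) uinv //.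
by rewrite unitmx_inv.
Qed.

End Deriv.

(** * The action of O(2) *)

Section Orthogonal.
Variable R : realType.
Local Notation C := R[i].
Implicit Types (p : {mpoly C[7]}) (X : s2 R).

(** With e the determinant, orthogonality reduces to two equations that [ring] can use as rewriting
    rules. *)
Lemma orth2P (k : 'M[R]_2) : k *m k^T = 1%:M ->
  exists e a b, [/\ e ^+ 2 = 1, b ^+ 2 = 1 - a ^+ 2 & k = mx2 a b (- (e * b)) (e * a)].
Proof.
rewrite [k]mx2E; move: (k 0 0) (k 0 1) (k 1 0) (k 1 1) => a b c d.
have -> : (mx2 a b c d)^T = mx2 a c b d.
  by apply/matrixP => i j; rewrite !mxE; case: (I2P i) => ->; case: (I2P j) => ->.
rewrite mul_mx2 => /matrixP E.
have := E 0 0; have := E 0 1; have := E 1 1; rewrite !mxE /= ?mulr1n ?mulr0n.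
move=> cd1 ac0 ab1; exists (a * d - b * c), a, b; split.
- have -> : (a * d - b * c) ^+ 2 = (a * a + b * b) * (c * c + d * d) - (a * c + b * d) ^+ 2 by ring.
  by rewrite ab1 cd1 ac0; ring.
- by rewrite -ab1; ring.
- congr mx2.
    have -> : - ((a * d - b * c) * b) = (a * a + b * b) * c - a * (a * c + b * d) by ring.
    by rewrite ab1 ac0; ring.
  have -> : (a * d - b * c) * a = (a * a + b * b) * d - b * (a * c + b * d) by ring.
  by rewrite ab1 ac0; ring.
Qed.

(** The action of the inverse, i.e. the transpose, of [k]: on symmetric traceless matrices, on
    antisymmetric ones through the determinant, and on v + w and w - v alike. *)
Definition orth_mx (k : 'M[R]_2) (i j : 'I_7) : R :=
  let: (a, b, c, d) := (k 0 0, k 0 1, k 1 0, k 1 1) in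
  (nth [::]
    [:: [:: a ^+ 2 - c ^+ 2; 2 * a * c; 0; 0; 0; 0; 0];
        [:: a * b - c * d; a * d + b * c; 0; 0; 0; 0; 0];
        [:: 0; 0; a * d - b * c; 0; 0; 0; 0];
        [:: 0; 0; 0; a; c; 0; 0];
        [:: 0; 0; 0; b; d; 0; 0];
        [:: 0; 0; 0; 0; 0; a; c];
        [:: 0; 0; 0; 0; 0; b; d]] i)`_j.

Lemma orth_invmx (k : 'M[R]_2) : k *m k^T = 1%:M -> invmx k = k^T.
Proof.
move=> kk; have [ku _] := mulmx1_unit kk.
by rewrite -[RHS](mulKmx ku) kk mulmx1.
Qed.

Lemma act_orth (k : 'M[R]_2) X i : k *m k^T = 1%:M ->
  act (invmx k) X 0 i = \sum_j orth_mx k i j * X 0 j.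
Proof.
move=> kk; rewrite /act /= invmxK (orth_invmx kk) big7 /orth_mx !inordK //.
rewrite [k]mx2E; move: (k 0 0) (k 0 1) (k 1 0) (k 1 1) => a b c d.
have -> : (mx2 a b c d)^T = mx2 a c b d.
  by apply/matrixP => r s; rewrite !mxE; case: (I2P r) => ->; case: (I2P s) => ->.
rewrite !mul_mx2 mul_mx2_col mul_row_mx2 !mxE /=.
by case: i => [[|[|[|[|[|[|[|//]]]]]]] lj] /=; field.
Qed.

Lemma orth_mx_qsgn (k : 'M[R]_2) (W : {set 'I_7}) i i' : k *m k^T = 1%:M ->
  W = W0 \/ W = W1 ->
  \sum_(j in W) qsgn R j * (orth_mx k i j * orth_mx k i' j) =
  if (i == i') && (i \in W) then qsgn R i else 0.
Proof.
move=> /orth2P[e [a [b [e2 b2 ->]]]] HW; rewrite big_mkcond big7.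
case: HW => ->; rewrite !inE /qsgn !inordK //= /orth_mx !inordK // !mxE /=.
all: case: i => [[|[|[|[|[|[|[|//]]]]]]] li];
  case: i' => [[|[|[|[|[|[|[|//]]]]]]] li'] //=.
all: rewrite ?(inj_eq val_inj) /=.
all: try by ring: e2 b2.
Qed.

Lemma orth_mx_gauss (k : 'M[R]_2) X : k *m k^T = 1%:M ->
  gauss (act (invmx k) X) = gauss X.
Proof.
move=> kk; rewrite /gauss; congr ((expR (- (pi * _)))%:C).
rewrite !big7 !(act_orth _ _ kk) !big7.
have [e [a [b [e2 b2 ->]]]] := orth2P kk.
rewrite /orth_mx !inordK // !mxE /=.
ring: e2 b2.
Qed.

Definition orth_sub (k : 'M[R]_2) (i : 'I_7) : {mpoly C[7]} :=
  \sum_j (orth_mx k i j)%:C *: 'X_j.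

Definition orth_comp (k : 'M[R]_2) p : {mpoly C[7]} :=
  p \mPo [tuple orth_sub k i | i < 7].

Lemma gl_translate_sch k p : k *m k^T = 1%:M ->
  gl_translate k (sch p) = sch (orth_comp k p).
Proof.
move=> kk; apply/funext => X; rewrite /gl_translate.
rewrite -[LHS]/(pfun p (act (invmx k) X) * gauss (act (invmx k) X)).
rewrite (orth_mx_gauss X kk) -[RHS]/(pfun (orth_comp k p) X * gauss X).
apply: (congr1 ( *%R^~ (gauss X))).
rewrite /orth_comp /pfun comp_mpoly_meval; apply: meval_eq => i.
rewrite tnth_mktuple /orth_sub raddf_sum /coordf act_orth //= rmorph_sum.
by apply: eq_bigr => j _; rewrite mevalZ mevalXU rmorphM.
Qed.

Lemma partial_translate k j p : k *m k^T = 1%:M ->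
  partial j (gl_translate k (sch p)) =
  gl_translate k (sch (\sum_i (orth_mx k i j)%:C *: sder (cpi R) i p)).
Proof.
move=> kk; apply/funext => X; rewrite /partial /gl_translate.
have cd : has_velocity (fun t => act (invmx k) (X + t *: delta_mx 0 j)) (fun i => orth_mx k i j).
  move=> i; have -> : (fun t => act (invmx k) (X + t *: delta_mx 0 j) 0 i) =
    cst (act (invmx k) X 0 i) + (orth_mx k i j) *: (id : R -> R).
    apply/funext => t; rewrite act_orth //= -[RHS]/(act (invmx k) X 0 i + orth_mx k i j * t).
    rewrite act_orth // (bigD1 j) //= [in RHS](bigD1 j) //= !mxE !eqxx /=.
    under eq_bigr => l /negPf lj do rewrite !mxE lj andbF mulr0 addr0.
    by rewrite mulr1 mulrDr addrAC.
  apply: is_derive_eq (is_deriveD (is_derive_cst _ _ _) (is_deriveZ _ (is_derive_id _ _))) _.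
  by rewrite add0r; exact: mulr1.
rewrite (has_cderiv0E (has_cderiv0_sch p cd)) scale0r addr0.
rewrite -[RHS]/(pfun (\sum_i (orth_mx k i j)%:C *: sder (cpi R) i p)
  (act (invmx k) X) * gauss (act (invmx k) X)).
rewrite /pfun raddf_sum /= mulr_suml; apply: eq_bigr => i _.
by rewrite mevalZ -mulrA.
Qed.
End Orthogonal.

(** * The algebra acts on coinvariants *)

Section Weil.
Variable R : realType.
Local Notation C := R[i].
Local Notation P := {mpoly C[7]}.
Implicit Types (p q u : {mpoly C[7]}) (X : s2 R) (L k : 'M[R]_2) (W : {set 'I_7}).

Definition sgn (j : 'I_7) : C := (qsgn R j)%:C.
Definition wlap W p : P := lap (cpi R) W sgn p.
Definition fcst : C := 'i%C / (4 * pi)%:C.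

Lemma weil_f_sch W p : weil_f W (sch p) = sch (fcst *: wlap W p).
Proof.
rewrite linearZ [X in _ = _ *: X]linear_sum /=.
apply: (congr1 (fun f : cfun R => fcst *: f)).
by apply: eq_bigr => j _; rewrite !partial_sch linearZ.
Qed.

(** GL_2 preserves Q_0 and Q_1, so gl_2 acts through the orthogonal Lie algebra of each block; this
    is the hypothesis of [vfield_lap]. *)
Lemma gl_mx_anti L W i j : W = W0 \/ W = W1 ->
  (j \in W)%:R * sgn j * gl_mx L i j = - ((i \in W)%:R * sgn i * gl_mx L j i).
Proof.
have H (b b' : bool) (x y x' y' : R) : b%:R * x * y = - (b'%:R * x' * y') ->
  b%:R * x%:C * y%:C = - (b'%:R * x'%:C * y'%:C).
  move=> E; have := congr1 (real_complex R) E.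
  by rewrite !(rmorphM, rmorphN, rmorph_nat).
move=> HW; apply: H.
case: HW => ->; rewrite !inE /qsgn.
all: case: i => [[|[|[|[|[|[|[|//]]]]]]] li];
  case: j => [[|[|[|[|[|[|[|//]]]]]]] li'] //=; rewrite /vf_mx /=.
all: by field.
Qed.

Lemma gl_deriv_weil_f L W p : W = W0 \/ W = W1 ->
  gl_deriv L (weil_f W (sch p)) = weil_f W (gl_deriv L (sch p)).
Proof.
move=> HW; rewrite gl_deriv_sch !weil_f_sch gl_deriv_sch.
rewrite /wlap -vfield_lap => [|i j]; last exact: gl_mx_anti.
by congr sch; rewrite linearZ.
Qed.

Lemma gl_translate_weil_f k W p : k *m k^T = 1%:M -> W = W0 \/ W = W1 ->
  gl_translate k (weil_f W (sch p)) = weil_f W (gl_translate k (sch p)).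
Proof.
move=> kk HW; rewrite weil_f_sch.
pose G i j : C := (orth_mx k i j)%:C.
have E j : partial j (partial j (gl_translate k (sch p))) =
  gl_translate k (sch (\sum_i \sum_i'
     (G i j * G i' j) *: sder (cpi R) i' (sder (cpi R) i p))).
  rewrite partial_translate // partial_translate //; congr (gl_translate k (sch _)).
  under eq_bigr => i _ do rewrite linear_sum scaler_sumr.
  rewrite exchange_big; apply: eq_bigr => i _; apply: eq_bigr => i' _ /=.
  by rewrite linearZ /= scalerA mulrC.
have <- : \sum_(j in W) sgn j *: (\sum_i \sum_i'
   (G i j * G i' j) *: sder (cpi R) i' (sder (cpi R) i p)) = wlap W p.
  apply: lap_change => i i'.
  have := congr1 (real_complex R) (orth_mx_qsgn i i' kk HW).
  rewrite rmorph_sum /= [X in _ = X -> _](fun_if (real_complex R)) => H.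
  rewrite -[RHS]H; apply: eq_bigr => j _.
  by rewrite !rmorphM.
rewrite linearZ -[LHS]/(fcst *: gl_translate k _).
apply: (congr1 (fun f : cfun R => fcst *: f)).
apply/funext => X; rewrite /gl_translate linear_sum !fct_sumE; apply: eq_bigr => j _ /=.
by rewrite E linearZ.
Qed.

End Weil.

Section Coinvariants.
Variable R : realType.
Local Notation C := R[i].
Local Notation P := {mpoly C[7]}.
Implicit Types (p q u : {mpoly C[7]}) (X : s2 R) (L k : 'M[R]_2) (W : {set 'I_7}).
Local Notation coinv := (@coinv_sub R).

Lemma coinv_subspace : is_subspace coinv.
Proof.
split.
- by move=> M [[M0 _ _] _].
- move=> f g Hf Hg M MM; have [[_ MD _] _] := MM.
  by apply: MD; [apply: Hf | apply: Hg].
- move=> a f Hf M MM; have [[_ _ MZ] _] := MM.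
  by apply: MZ; apply: Hf.
Qed.

Lemma frakA_subalgebra : is_subalgebra (@frakA R).
Proof.
split.
- by move=> M [[M1 _ _ _] _].
- move=> f g Hf Hg M MM; have [[_ MD _ _] _] := MM.
  by apply: MD; [apply: Hf | apply: Hg].
- move=> a f Hf M MM; have [[_ _ MZ _] _] := MM.
  by apply: MZ; apply: Hf.
- move=> f g Hf Hg M MM; have [[_ _ _ MC] _] := MM.
  by apply: MC; [apply: Hf | apply: Hg].
Qed.

Lemma schD p q : sch (p + q) = sch p + sch q. Proof. exact: linearD. Qed.
Lemma schB p q : sch (p - q) = sch p - sch q. Proof. exact: linearB. Qed.
Lemma schZ (a : C) p : sch (a *: p) = a *: sch p. Proof. exact: linearZ. Qed.

Definition stable_on_S2 (D : cfun R -> cfun R) : Prop :=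
  forall p, exists q, D (sch p) = sch q.

Lemma sch_mul u p : sch (u * p) = pfun u * sch p.
Proof.
apply/funext => X; rewrite -[LHS]/(pfun (u * p) X * gauss X).
by rewrite -[RHS]/(pfun u X * (pfun p X * gauss X)) mulrA /pfun mevalM.
Qed.

Lemma coordf_sch j p : coordf j * sch p = sch ('X_j * p).
Proof.
rewrite sch_mul; apply: (congr1 ( *%R^~ (sch p))); apply/funext => X.
by rewrite /pfun mevalXU.
Qed.

Lemma weil_e_sch W p : exists q, weil_e W (sch p) = sch q.
Proof.
pose u : P := \sum_(j in W) (2^-1 * sgn R j) *: 'X_j ^+ 2.
exists (((2 * pi)%:C * 'i%C) *: (u * p)).
rewrite schZ sch_mul; apply/funext => X; rewrite /weil_e.
rewrite -[RHS]/((2 * pi)%:C * 'i%C * (pfun u X * sch p X)) mulrA.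
congr (_ * _ * _); rewrite /qform rmorphM rmorph_sum mulr_sumr /pfun raddf_sum.
apply: eq_bigr => j _ /=.
by rewrite !expr2 mevalZ mevalM mevalXU -mulrA !rmorphM fmorphV rmorph_nat.
Qed.

Lemma weil_h_sch W p : exists q, weil_h W (sch p) = sch q.
Proof.
exists ((#|W|%:R / 2) *: p + \sum_(j in W) 'X_j * sder (cpi R) j p).
rewrite schD schZ linear_sum /weil_h.
apply: (congr1 (fun f : cfun R => _ + f)).
by apply: eq_bigr => j _; rewrite partial_sch coordf_sch.
Qed.

(** The operators witnessing generation are arbitrary members of [frakA]; their values on the
    generators must stay within reach of the polynomial calculus. *)
Lemma frakA_stable D : frakA D -> stable_on_S2 D.
Proof.
apply: smallest_sub => {D}.
  split.
  - by move=> p; exists p.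
  - move=> D E HD HE p; have [q ->] := HD p; have [r ->] := HE p.
    by exists (q + r); rewrite schD.
  - by move=> a D HD p; have [q ->] := HD p; exists (a *: q); rewrite schZ.
  - by move=> D E HD HE p /=; have [q ->] := HE p; apply: HD.
move=> D [[A [B [_ _ ->]]]|[u _ ->]] p; last by exists (u * p); rewrite sch_mul.
have weilE W A' : exists q, weil W A' (sch p) = sch q.
  have [qh Eh] := weil_h_sch W p; have [qe Ee] := weil_e_sch W p.
  exists (A' 0 0 *: qh + A' 0 1 *: qe + A' 1 0 *: (fcst R *: wlap W p)).
  by rewrite /weil Eh Ee weil_f_sch !schD !schZ.
have [q Eq] := weilE W0 A; have [r Er] := weilE W1 B.
by exists (q + r); rewrite /omega Eq Er schD.
Qed.

(** Conditions on the polynomial part that make [A] preserve the relations defining the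
    coinvariants. *)
Definition intertwiner (A : cfun R -> cfun R) (a : P -> P) : Prop :=
  [/\ linear a, forall p, A (sch p) = sch (a p),
      forall L p, gl_deriv L (A (sch p)) = A (gl_deriv L (sch p)) &
      forall k p, k *m k^T = 1%:M ->
        gl_translate k (A (sch p)) = A (gl_translate k (sch p))].

(** Induction over the smallest subspace. A polynomial representative belongs to the induction
    property because [A] is controlled only on functions [sch q]; the choice of q is harmless, as
    [sch (a q)] equals [A (sch q)]. *)
Lemma intertwiner_coinv A a p : intertwiner A a ->
  coinv (sch p) -> coinv (sch (a p)).
Proof.
case=> a_lin AE AL Ak.
pose lin := GRing.isLinear.Build C P P *:%R a a_lin.
pose f : {linear P -> P} := HB.pack a lin.
have [c0 cD cZ] := coinv_subspace.
have gen Psi : coinv_gens Psi -> coinv Psi by move=> H M [_]; apply.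
suff H : forall Phi, coinv Phi -> exists2 q, Phi = sch q & coinv (sch (f q)).
  move=> /H[q E]; rewrite -[f q]/(a q) -[a p]/(f p).
  by rewrite -[sch (f p)]AE E AE.
apply: smallest_sub.
  split.
  - by exists 0; rewrite ?linear0.
  - move=> _ _ [q -> Hq] [r -> Hr]; exists (q + r); first by rewrite schD.
    by rewrite linearD schD; apply: cD.
  - move=> b _ [q -> Hq]; exists (b *: q); first by rewrite schZ.
    by rewrite linearZ schZ; apply: cZ.
move=> _ [[L [_ [[q ->] ->]]]|[k [_ [kk [q ->] ->]]]].
- exists (vfield (cpi R) (gl_mx L) q); first by rewrite -gl_deriv_sch.
  apply: gen; left; exists L, (sch (a q)); split; first by exists (a q).
  by rewrite -[f _]/(a _) -AE -gl_deriv_sch -AL AE.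
- exists (orth_comp k q - eta k *: q).
    by rewrite schB schZ -gl_translate_sch.
  apply: gen; right; exists k, (sch (a q)); split => //; first by exists (a q).
  rewrite linearB linearZ schB schZ -[f q]/(a q) -[f _]/(a _) -AE -gl_translate_sch //.
  by rewrite -Ak // AE.
Qed.

End Coinvariants.

(** * Invariant multipliers and the generated submodule *)

Section Glue.
Variable R : realType.
Local Notation C := R[i].
Local Notation P := {mpoly C[7]}.
Implicit Types (p q u : {mpoly C[7]}) (X : s2 R) (L k : 'M[R]_2) (W : {set 'I_7}).
Local Notation coinv := (@coinv_sub R).

Lemma pfun_intertwiner u : GL2_invariant u ->
  intertwiner (fun Phi : cfun R => pfun u * Phi) ( *%R u).
Proof.
move=> uinv; split.
- by move=> a p q; rewrite mulrDr scalerAr.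
- by move=> p; rewrite sch_mul.
- by move=> L p; apply: gl_deriv_inv.
- by move=> k p kk; apply: gl_translate_inv => //; case: (mulmx1_unit kk).
Qed.

Lemma weil_f_intertwiner W : W = W0 \/ W = W1 ->
  intertwiner (weil_f W) (fun p => fcst R *: wlap W p).
Proof.
move=> HW; split.
- move=> a p q.
  have -> : wlap W (a *: p + q) = a *: wlap W p + wlap W q by exact: lap_is_linear.
  by rewrite scalerDr !scalerA (mulrC (fcst R) a).
- exact: weil_f_sch.
- by move=> L p; apply: gl_deriv_weil_f.
- by move=> k p kk; apply: gl_translate_weil_f.
Qed.

Lemma frakA_gen D : frakA_gens D -> @frakA R D.
Proof. by move=> H M [_]; apply. Qed.

Lemma frakA_pfun u : GL2_invariant u -> frakA (fun Phi : cfun R => pfun u * Phi).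
Proof. by move=> uinv; apply: frakA_gen; right; exists u. Qed.

Lemma frakA_weil_f W : W = W0 \/ W = W1 -> frakA (@weil_f R W).
Proof.
pose A : 'M[C]_2 := delta_mx 1 0.
have trA : \tr A = 0.
  by rewrite /mxtrace !big_ord_recl big_ord0 !mxE /= !addr0.
have tr0 : \tr (0 : 'M[C]_2) = 0 by rewrite mxtrace0.
have w0 V (Phi : cfun R) : weil V 0 Phi = 0.
  by rewrite /weil !mxE !scale0r !addr0.
have wA V (Phi : cfun R) : weil V A Phi = weil_f V Phi.
  by rewrite /weil !mxE /= !scale0r !add0r scale1r.
case=> ->; apply: frakA_gen; left.
  by exists A, 0; split => //; apply/funext => Phi; rewrite /omega w0 wA addr0.
by exists 0, A; split => //; apply/funext => Phi; rewrite /omega w0 wA add0r.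
Qed.

Lemma point_act (g : 'M[R]_2) X : g \in unitmx ->
  Defs.point (act g X) = (g *m (Defs.point X).1.1 *m invmx g,
    g *m (Defs.point X).1.2, (Defs.point X).2 *m invmx g).
Proof.
move=> gu; rewrite /act; case: (Defs.point X) (tr_point X) => -[y v] w ty.
by rewrite coordsK //= mxtrace_mulC mulmxA mulVmx // mul1mx.
Qed.

Lemma pfun_quad0 X : pfun (quad0 C) X = (2 * qform W0 X)%:C.
Proof.
rewrite /qform mulrA divff ?pnatr_eq0 // mul1r big_mkcond big7 !inE !inordK //=.
rewrite /qsgn !inordK //= /quad0 !mvarE /pfun.
rewrite !(mevalB, mevalD) !expr2 !mevalM !mevalXU /coordf.
rewrite !(rmorphD, rmorphM, rmorphN) /= !addr0; ring.
Qed.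

Lemma pfun_quad1 X : pfun (quad1 C) X = (2 * qform W1 X)%:C.
Proof.
rewrite /qform mulrA divff ?pnatr_eq0 // mul1r big_mkcond big7 !inE !inordK //=.
rewrite /qsgn !inordK //= /quad1 !mvarE /pfun.
rewrite !(mevalB, mevalD) !expr2 !mevalM !mevalXU /coordf.
rewrite !(rmorphD, rmorphM, rmorphN) /= !add0r; ring.
Qed.

Lemma quad0_invariant : GL2_invariant (quad0 C).
Proof.
move=> g gu X; rewrite !pfun_quad0; congr ((2 * _)%:C).
have E Y : qform W0 Y = \tr ((Defs.point Y).1.1 *m (Defs.point Y).1.1) by exact: qform_W0.
rewrite !E point_act //; move: (Defs.point X) => -[[y v] w] /=.
by rewrite !mulmxA mulmxKV // mxtrace_mulC !mulmxA mulVmx // mul1mx.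
Qed.

Lemma quad1_invariant : GL2_invariant (quad1 C).
Proof.
move=> g gu X; rewrite !pfun_quad1; congr ((2 * _)%:C).
have E Y : qform W1 Y = 2 * ((Defs.point Y).2 *m (Defs.point Y).1.2) 0 0 by exact: qform_W1.
rewrite !E point_act //; move: (Defs.point X) => -[[y v] w] /=.
by rewrite -mulmxA mulKmx.
Qed.

Lemma pfun_cub X : pfun (cub C) X =
  (8 * ((Defs.point X).2 *m (Defs.point X).1.1 *m (Defs.point X).1.2) 0 0)%:C.
Proof.
rewrite /Defs.point /= mul_row_mx2 !mxE !big_ord_recl big_ord0 !mxE /=.
rewrite /cub !mvarE !expr2 -!mpolyC_nat /pfun !(mevalD, mevalN, mevalM, mevalXU, mevalC) /coordf.
rewrite -(rmorph_nat (real_complex R)).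
rewrite -!(rmorphD, rmorphM, rmorphN) /=; congr (_%:C); by field.
Qed.

Lemma cub_invariant : GL2_invariant (cub C).
Proof.
move=> g gu X; rewrite !pfun_cub point_act //.
move: (Defs.point X) => -[[y v] w] /=; congr ((8 * _)%:C).
by rewrite !mulmxA mulmxKV // -!mulmxA mulKmx.
Qed.

(** The predicate to which the descent is applied. *)
Definition generated (fs : seq (cfun R)) p : Prop :=
  exists2 D : nat -> cfun R -> cfun R, forall i, frakA (D i) &
    coinv_eq (sch p) (\sum_(i < size fs) D i fs`_i).

Section Generated.
Variable fs : seq (cfun R).
Hypothesis fs_S2 : forall i, (i < size fs)%N -> exists p, fs`_i = sch p.
Local Notation M := (generated fs).

Lemma generatedD p q : M p -> M q -> M (p + q).
Proof.
have [_ AD _ _] := @frakA_subalgebra R; have [_ cD _] := coinv_subspace R.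
case=> [D HD Hp] [E HE Hq]; exists (fun i Phi => D i Phi + E i Phi).
  by move=> i; apply: AD.
rewrite /coinv_eq schD big_split opprD addrACA; exact: cD.
Qed.

Lemma generatedZ (a : C) p : M p -> M (a *: p).
Proof.
have [_ _ AZ _] := @frakA_subalgebra R; have [_ _ cZ] := coinv_subspace R.
case=> [D HD Hp]; exists (fun i Phi => a *: D i Phi).
  by move=> i; apply: AZ.
by rewrite /coinv_eq schZ -scaler_sumr -scalerBr; apply: cZ.
Qed.

Lemma generated_coinv p : coinv (sch p) -> M p.
Proof.
have [A1 _ AZ _] := @frakA_subalgebra R.
move=> Hp; exists (fun _ Phi => 0 *: Phi).
  by move=> i; apply: (AZ 0 id).
by rewrite /coinv_eq big1 ?subr0 // => i _; rewrite scale0r.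
Qed.

Lemma generated_gen i p : (i < size fs)%N -> fs`_i = sch p -> M p.
Proof.
have [A1 _ AZ _] := @frakA_subalgebra R; have [c0 _ _] := coinv_subspace R.
move=> ifs E; exists (fun j Phi => (j == i)%:R *: Phi).
  by move=> j; apply: (AZ _ id).
rewrite /coinv_eq (bigD1 (Ordinal ifs)) //= eqxx scale1r E big1 ?addr0 ?subrr //.
by move=> j /negPf ji; rewrite -val_eqE /= in ji; rewrite ji scale0r.
Qed.

(** Compose every [D i] with [A]. Distributing [A] over the sum uses linearity of [a], once all
    [D i] applied to generators are known to be polynomials times the Gaussian. *)
Lemma generated_intertwiner A a p : frakA A -> intertwiner A a -> M p -> M (a p).
Proof.
move=> HA iA [D HD Hp]; have [a_lin AE _ _] := iA.
pose f : {linear P -> P} := HB.pack a (GRing.isLinear.Build C P P *:%R a a_lin).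
have [_ _ _ AC] := @frakA_subalgebra R.
exists (fun i => A \o D i); first by move=> i; apply: AC.
have H (i : 'I_(size fs)) : exists q, D i fs`_i = sch q.
  by have [r ->] := fs_S2 (ltn_ord i); apply: frakA_stable.
have [s Hs] := choice H.
move: Hp; rewrite /coinv_eq (eq_bigr (fun i => sch (s i))) //.
rewrite -linear_sum -schB => /(intertwiner_coinv iA).
rewrite -[a _]/(f _) linearB linear_sum schB linear_sum.
congr (coinv (_ - _)); apply: eq_bigr => i _ /=.
by rewrite Hs AE.
Qed.
End Generated.
End Glue.

(** * Leading terms in the Fock model *)

Section Fock.
Variable R : realType.
Local Notation C := R[i].
Local Notation P := {mpoly C[7]}.
Implicit Types (p q u h : {mpoly C[7]}).

(** The value is 4 pi: the operator 2 pi x - d/dx applied to [p * gauss] receives a second 2 pi x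
    from the derivative of the Gaussian. *)
Definition creat_cst : C := 2 * cpi R.

Definition has_top (k : nat) (f q : P) : Prop :=
  (msize f <= k.+1)%N /\ (msize (q - creat_cst ^+ k *: f) <= k)%N.

Lemma creation_sch j p :
  creation j (sch p) = sch (creat_cst *: ('X_j * p) - p^`M(j)).
Proof.
rewrite /creation partial_sch coordf_sch -/(cpi R) -schZ -schB; congr sch.
by rewrite /sder opprB addrA -scalerDl /creat_cst mulr_natl mulr2n.
Qed.

Lemma has_top_creation k j f q : has_top k f q ->
  has_top k.+1 ('X_j * f) (creat_cst *: ('X_j * q) - q^`M(j)).
Proof.
case=> fk qk; split; first by rewrite -(add1n k.+1) msize_mul ?msize_XU.
have -> : creat_cst *: ('X_j * q) - q^`M(j) - creat_cst ^+ k.+1 *: ('X_j * f) =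
    creat_cst *: ('X_j * (q - creat_cst ^+ k *: f)) - q^`M(j).
  by rewrite mulrBr scalerBr -scalerAr scalerA -exprS addrAC.
apply: msize_sub; first by rewrite msize_scale // -(add1n k) msize_mul ?msize_XU.
apply/leqW/msize_mderiv; rewrite -[q](subrK (creat_cst ^+ k *: f)).
by apply: msize_add; [exact: leqW | exact: msize_scale].
Qed.

Lemma creation_monomial_top (m : 'X_{1..7}) :
  exists2 q, creation_monomial m = sch q & has_top (mdeg m) 'X_[m] q.
Proof.
rewrite mdegE mpolyXE_id /creation_monomial.
rewrite -[index_enum _]/(index_enum 'I_7) -!big_enum /= .
(* The degree, the monomial and the creation operators are now folds over one list, so a single
   induction compares them. *)
elim: (enum 'I_7) => [|j s [q Eq Hq]] /=.
  rewrite !big_nil; exists 1.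
    apply/funext => X; rewrite -[RHS]/((1 : P).@[_] * gauss X).
    by rewrite meval1 mul1r.
  by split; rewrite ?msize1 // expr0 scale1r subrr msize0.
rewrite !big_cons Eq; elim: (m j) => [|n [r Er Hr]].
  by exists q; rewrite // expr0 mul1r.
rewrite iterS Er creation_sch exprS -mulrA addSn; eexists; first by [].
exact: has_top_creation.
Qed.

(** By homogeneity all monomials of [h] acquire the same power of 4 pi, so the leading term is a
    multiple of [h] itself. *)
Lemma iota_inv_top k h : h \is k.-homog ->
  exists2 r, (msize r <= k)%N & iota_inv h = sch (creat_cst ^+ k *: h + r).
Proof.
move=> /dhomogP hk.
suff [q Eq Hq] : exists2 q, iota_inv h = sch q & (msize (q - creat_cst ^+ k *: h) <= k)%N.
  by exists (q - creat_cst ^+ k *: h) => //; rewrite addrC subrK.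
rewrite /iota_inv {3}[h]mpolyE.
have : {subset msupp h <= msupp h} by [].
elim: {1 3 4}(msupp h) => [|m s IHs] sh.
  by exists 0; rewrite ?linear0 big_nil // scaler0 subr0 msize0.
have [|q Eq Hq] := IHs; first by move=> m' m's; apply: sh; rewrite inE m's orbT.
have [r Er [_ Hr]] := creation_monomial_top m.
exists (h@_m *: r + q); first by rewrite big_cons Er Eq schD schZ.
rewrite big_cons scalerDr opprD addrACA msize_add //.
rewrite scalerA (mulrC (creat_cst ^+ k)) -scalerA -scalerBr msize_scale //.
by have := hk m (sh m (mem_head _ _)) => mk; rewrite mk in Hr.
Qed.

Lemma creat_cst_neq0 : creat_cst != 0.
Proof.
have p0 : (pi : R) != 0 by rewrite gt_eqF // pi_gt0.
rewrite /creat_cst /cpi mulf_neq0 ?pnatr_eq0 //.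
by rewrite (fmorph_eq0 (real_complex R)) mulf_neq0 ?pnatr_eq0.
Qed.

Lemma orth_comp_refl p : orth_comp (mx2 1 0 0 (-1) : 'M[R]_2) p = p \mPo refl_sub C.
Proof.
rewrite /orth_comp; congr (comp_mpoly _ p); apply: eq_from_tnth => i.
rewrite tnth_mktuple (tnth_nth 0) /orth_sub big7 /orth_mx !inordK // !mxE /= -!mvarE.
by case: i => [[|[|[|[|[|[|[|//]]]]]]] li] /=;
  rewrite ?(expr0n, expr1n, mulr0, mul0r, mulr1, mul1r, addr0, add0r,
    subr0, oppr0, scale0r, scale1r, rmorphN1, scaleN1r).
Qed.

End Fock.

(** * Verification of the closure conditions and conclusion *)

Section Final.
Variable R : realType.
Local Notation C := R[i].
Implicit Types (p q u h : {mpoly C[7]}).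

Lemma wlap_W0 p : wlap W0 p = lap0 (cpi R) p.
Proof. by apply: lap_W0; rewrite /sgn /qsgn inordK //= rmorphN1. Qed.

Lemma wlap_W1 p : wlap W1 p = lap1 (cpi R) p.
Proof. by apply: lap_W1; rewrite /sgn /qsgn inordK //= rmorphN1. Qed.

Lemma fcst_neq0 : fcst R != 0.
Proof.
have p0 : (pi : R) != 0 by rewrite gt_eqF // pi_gt0.
rewrite /fcst mulf_neq0 ?neq0Ci // invr_eq0.
by rewrite (fmorph_eq0 (real_complex R)) mulf_neq0 ?pnatr_eq0.
Qed.

Section Gen.
Variable fs : seq (cfun R).
Hypothesis fs_S2 : forall i, (i < size fs)%N -> exists p, fs`_i = sch p.
Local Notation M := (generated fs).

Lemma generated_gl L p : M (vfield (cpi R) (gl_mx L) p).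
Proof.
apply: generated_coinv; rewrite -gl_deriv_sch.
by move=> N [_]; apply; left; exists L, (sch p); split => //; exists p.
Qed.

Lemma generated_lap W p : W = W0 \/ W = W1 -> M p -> M (wlap W p).
Proof.
move=> HW /(generated_intertwiner fs_S2 (@frakA_weil_f R W HW) (@weil_f_intertwiner R W HW)).
move/(generatedZ (fcst R)^-1).
by rewrite scalerA mulVf ?fcst_neq0 // scale1r.
Qed.

Lemma generated_pfun u p : GL2_invariant u -> M p -> M (u * p).
Proof.
move=> uinv.
exact: (@generated_intertwiner _ _ fs_S2 _ _ p (frakA_pfun uinv) (pfun_intertwiner uinv)).
Qed.

Lemma generated_refl p : M (p \mPo refl_sub C + p).
Proof.
apply: generated_coinv => N [_]; apply; right.
exists (mx2 1 0 0 (-1)), (sch p).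
have tr : (mx2 1 0 0 (-1) : 'M[R]_2)^T = mx2 1 0 0 (-1).
  by apply/matrixP => r s; rewrite !mxE; case: (I2P r) => ->; case: (I2P s) => ->.
have kk : (mx2 1 0 0 (-1) : 'M[R]_2) *m (mx2 1 0 0 (-1))^T = 1%:M.
  rewrite tr mul_mx2; apply/matrixP => r s; rewrite !mxE.
  by case: (I2P r) => ->; case: (I2P s) => -> /=; rewrite ?mulr1n ?mulr0n; ring.
split => //; first by exists p.
rewrite gl_translate_sch // orth_comp_refl schD /eta det_mx2.
by rewrite mul1r mul0r subr0 sgrN1 rmorphN1 scaleN1r opprK.
Qed.

Lemma generated_vfield L t p : (forall j k, vf_mx L j k = table t j k) ->
  M (vfield (cpi R) (table (map (map (real_complex R)) t)) p).
Proof.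
move=> E; rewrite -(@vfield_table _ _ (gl_mx L)) => [|j k].
  exact: generated_gl.
rewrite /gl_mx E /table; have [jt|tj] := ltnP j (size t); last first.
  by rewrite !nth_default ?size_map // ?nth_default.
rewrite (nth_map [::]) //; have [kt|tk] := ltnP k (size (nth [::] t j)).
  by rewrite (nth_map 0).
by rewrite (nth_default 0 tk) [RHS]nth_default ?size_map.
Qed.

Lemma generated_closed_submodule :
  (exists a r, [/\ a != 0, (msize r <= 1)%N & M (a *: ze C + r)]) ->
  (exists a r, [/\ a != 0, (msize r <= 3)%N &
     M (a *: (zp 'i%C * am 'i%C ^+ 2) + r)]) ->
  (exists a r, [/\ a != 0, (msize r <= 3)%N &
     M (a *: (zp 'i%C * bm 'i%C ^+ 2) + r)]) ->
  closed_submodule (cpi R) 'i%C M.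
Proof.
move=> Mze Mzpam Mzpbm; split.
- exact: generatedD.
- exact: generatedZ.
- by move=> p; apply: generated_pfun (@quad0_invariant R).
- by move=> p; apply: generated_pfun (@quad1_invariant R).
- by move=> p; rewrite -wlap_W0; apply: generated_lap; left.
- by move=> p; rewrite -wlap_W1; apply: generated_lap; right.
- by move=> p; apply: generated_pfun (@cub_invariant R).
- move=> p; rewrite -vfield_rot.
  (* This matrix, the identity, diag(1, -1) and the symmetric off-diagonal matrix form a basis of
     gl_2; each yields one of the four vector fields. *)
  have := @generated_vfield (mx2 0 1 (-1) 0)
    [:: [:: 0; - 2%:R; 0; 0; 0; 0; 0]; [:: 2%:R; 0; 0; 0; 0; 0; 0]; [::];
        [:: 0; 0; 0; 0; -1; 0; 0]; [:: 0; 0; 0; 1; 0; 0; 0];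
        [:: 0; 0; 0; 0; 0; 0; -1]; [:: 0; 0; 0; 0; 0; 1; 0]] p.
  rewrite /= !rmorphN !rmorph0 !rmorph1 !rmorph_nat; apply=> j k.
  rewrite /vf_mx /table !mxE /=.
  by case: j => [[|[|[|[|[|[|[|//]]]]]]] lj]; case: k => [[|[|[|[|[|[|[|//]]]]]]] lk] //=; field.
- move=> p; rewrite -vfield_scal.
  have := @generated_vfield 1%:M
    [:: [::]; [::]; [::];
        [:: 0; 0; 0; 0; 0; 1; 0]; [:: 0; 0; 0; 0; 0; 0; 1];
        [:: 0; 0; 0; 1; 0; 0; 0]; [:: 0; 0; 0; 0; 1; 0; 0]] p.
  rewrite /= !rmorph0 !rmorph1; apply=> j k.
  rewrite /vf_mx /table !mxE /=.
  by case: j => [[|[|[|[|[|[|[|//]]]]]]] lj]; case: k => [[|[|[|[|[|[|[|//]]]]]]] lk] //=; field.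
- move=> p; rewrite -vfield_diag.
  have := @generated_vfield (mx2 1 0 0 (-1))
    [:: [::]; [:: 0; 0; - 2%:R; 0; 0; 0; 0]; [:: 0; - 2%:R; 0; 0; 0; 0; 0];
        [:: 0; 0; 0; 0; 0; 1; 0]; [:: 0; 0; 0; 0; 0; 0; -1];
        [:: 0; 0; 0; 1; 0; 0; 0]; [:: 0; 0; 0; 0; -1; 0; 0]] p.
  rewrite /= !rmorphN !rmorph0 !rmorph1 !rmorph_nat; apply=> j k.
  rewrite /vf_mx /table !mxE /=.
  by case: j => [[|[|[|[|[|[|[|//]]]]]]] lj]; case: k => [[|[|[|[|[|[|[|//]]]]]]] lk] //=; field.
- move=> p; rewrite -vfield_symm.
  have := @generated_vfield (mx2 0 1 1 0)
    [:: [:: 0; 0; 2%:R; 0; 0; 0; 0]; [::]; [:: 2%:R; 0; 0; 0; 0; 0; 0];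
        [:: 0; 0; 0; 0; 0; 0; 1]; [:: 0; 0; 0; 0; 0; 1; 0];
        [:: 0; 0; 0; 0; 1; 0; 0]; [:: 0; 0; 0; 1; 0; 0; 0]] p.
  rewrite /= !rmorph0 !rmorph1 !rmorph_nat; apply=> j k.
  rewrite /vf_mx /table !mxE /=.
  by case: j => [[|[|[|[|[|[|[|//]]]]]]] lj]; case: k => [[|[|[|[|[|[|[|//]]]]]]] lk] //=; field.
- exact: generated_refl.
- exact: Mze.
- exact: Mzpam.
- exact: Mzpbm.
Qed.

End Gen.

Lemma fock_varE k : fock_var R k = mvar C k. Proof. by rewrite mvarE. Qed.

Lemma fock_zetaE : fock_zeta R = ze C. Proof. exact: fock_varE. Qed.

Lemma fock_zpE : fock_zp R = zp 'i%C.
Proof. by rewrite /fock_zp /zp !fock_varE imagCE mul_mpolyC. Qed.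

Lemma fock_zm'E : fock_zm' R = am 'i%C.
Proof. by rewrite /fock_zm' /am !fock_varE imagCE mul_mpolyC. Qed.

Lemma fock_zetam'E : fock_zetam' R = bm 'i%C.
Proof. by rewrite /fock_zetam' /bm !fock_varE imagCE mul_mpolyC. Qed.

Lemma x_homog k : mvar C k \is 1.-homog.
Proof. by rewrite mvarE dhomogX /= mdeg1. Qed.

Lemma xJx_homog k l : (mvar C k + imagC 'i%C * mvar C l \is 1.-homog) &&
  (mvar C k - imagC 'i%C * mvar C l \is 1.-homog).
Proof.
rewrite imagCE mul_mpolyC; have H : 'i%C *: mvar C l \is 1.-homog.
  by apply: dhomogZ; apply: x_homog.
by rewrite !rpredD ?x_homog ?rpredN.
Qed.

End Final.

Theorem theorem6p2 (R : realType) :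
  coinv_generated_by
    [:: iota_inv (fock_zeta R);
        iota_inv (fock_zp R * fock_zm' R ^+ 2);
        iota_inv (fock_zp R * fock_zetam' R ^+ 2)].
Proof.
rewrite fock_zetaE fock_zpE fock_zm'E fock_zetam'E.
set fs := (X in coinv_generated_by X).
have [zp1 am1] : zp 'i%C \is [in R[i][7], 1.-homog] /\ am 'i%C \is [in R[i][7], 1.-homog].
  by case/andP: (xJx_homog R 0 1); case/andP: (xJx_homog R 3 4).
have bm1 : bm 'i%C \is [in R[i][7], 1.-homog] by case/andP: (xJx_homog R 5 6).
have [r0 sr0 Er0] := iota_inv_top (x_homog R 2).
have [r1 sr1 Er1] := iota_inv_top (dhomogM zp1 (dhomogMn 2 am1)).
have [r2 sr2 Er2] := iota_inv_top (dhomogM zp1 (dhomogMn 2 bm1)).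
have fs_S2 i : (i < size fs)%N -> exists p, fs`_i = sch p.
  case: i => [|[|[|//]]] _ /=.
  - by rewrite Er0; eexists.
  - by rewrite Er1; eexists.
  - by rewrite Er2; eexists.
have a0 k : creat_cst R ^+ k != 0 by rewrite expf_neq0 // creat_cst_neq0.
have cpi0 : cpi R != 0 by have := creat_cst_neq0 R; rewrite mulf_eq0 negb_or => /andP[].
have iK2 : 'i%C * 'i%C = -1 :> R[i] by rewrite -expr2 sqr_i.
have HM : closed_submodule (cpi R) 'i%C (generated fs).
  apply: (generated_closed_submodule fs_S2).
  - exists (creat_cst R ^+ 1), r0; split => //.
    by apply: (@generated_gen _ fs 0) => //; exact: Er0.
  (* The exponent is the degree 3 in the form produced by [dhomogM] and [dhomogMn]. *)
  - exists (creat_cst R ^+ (1 + 1 * 2)), r1; split => //.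
    by apply: (@generated_gen _ fs 1) => //; exact: Er1.
  - exists (creat_cst R ^+ (1 + 1 * 2)), r2; split => //.
    by apply: (@generated_gen _ fs 2) => //; exact: Er2.
by move=> _ [p ->]; exact: (closed_submodule_full cpi0 iK2 HM p).
Qed.
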